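(* Periodic stumpons, unlike periodic cuspons, are not conservative solutions of the Camassa--Holm equation. Precisely, for $u:\mathbb{R}\times\mathbb{R}\to\mathbb{R}$ put $$P(t,x)=\int_{\mathbb{R}}\frac12 e^{-|x-z|}\left(u^2+\frac12u_x^2\right)(t,z)\,dz$$ and consider the conservation law $$(u^2+u_x^2)_t+\left(u(u^2+u_x^2)\right)_x=(u^3-2Pu)_x. \qquad ( * )$$ (i) If $u$ is a periodic stumpon, then $u$ does not satisfy $( * )$ in the weak sense. (ii) If $u$ is a periodic cuspon, then $u$ satisfies $( * )$ in the weak sense.
   Context: The Camassa--Holm equation (with $\kappa=0$) is $u_t-u_{txx}+3uu_x-2u_xu_{xx}-uu_{xxx}=0$, or in nonlocal form $u_t+uu_x+P_x=0$, $P-P_{xx}=u^2+\frac12u_x^2$. Weak sense: $u$ satisfies $( * )$ in the weak sense if for every $\Phi\in C_c^\infty(\mathbb{R}^2)$, $$\iint_{\mathbb{R}^2}\left((u^2+u_x^2)\Phi_t+\left(u(u^2+u_x^2)-u^3+2Pu\right)\Phi_x\right)(t,x)\,dx\,dt=0,$$ where $u_x$ is the weak derivative. Periodic cuspon: let $M,s,m\in\mathbb{R}$, $z=s-M-m$, with either $z<m<s<M$ or $z>m>s>M$. A periodic cuspon profile with these parameters is a continuous function $\phi:\mathbb{R}\to\mathbb{R}$, periodic with period $2L$ for some $L>0$, that is $C^\infty$ on $\mathbb{R}\setminus 2L\mathbb{Z}$ and satisfies there $$(\phi')^2=\frac{(M-\phi)(\phi-m)(\phi-z)}{s-\phi},$$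 with $\phi(-x)=\phi(x)$, $\phi(0)=s$, $\phi(L)=m$, $\phi'(L)=0$, and, for $0<x<L$, $\phi'(x)<0$ if $s>m$, respectively $\phi'(x)>0$ if $s<m$. (The value $s$ is the maximum of $\phi$ and $m$ its minimum if $s>m$, and conversely if $s<m$.) A periodic cuspon is $u(t,x)=\phi(x-x_0-st)$ with $x_0\in\mathbb{R}$. Periodic stumpon: assume in addition that the parameters satisfy $$-Mm-(M+m)(s-M-m)=s^2,$$ let $\phi$ be the corresponding periodic cuspon profile of period $2L$, and let $\ell>0$. The stumpon profile $\psi$ is the $2(L+\ell)$-periodic function given by $\psi(x)=s$ for $|x|<\ell$ and $\psi(x)=\phi(|x|-\ell)$ for $\ell\le|x|\le\ell+L$. A periodic stumpon is $u(t,x)=\psi(x-x_0-st)$ with $x_0\in\mathbb{R}$. *)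

(* Defs.v *)
From HB Require Import structures.
From mathcomp Require Import all_boot all_order all_algebra.
From mathcomp Require Import all_classical all_reals all_analysis.
Set Implicit Arguments.
Unset Strict Implicit.
Unset Printing Implicit Defensive.
Import Order.TTheory GRing.Theory Num.Theory.
Import numFieldNormedType.Exports.
Local Open Scope ring_scope.
Local Open Scope classical_set_scope.

(* A point of the plane is p = (t, x): p.1 is the time, p.2 the position. *)

Section TestFunctions.
Context {R : realType}.
Implicit Types F : R * R -> R.

Definition partial_t F : R * R -> R := fun p => (fun t => F (t, p.2))^`() p.1.
Definition partial_x F : R * R -> R := fun p => (fun x => F (p.1, x))^`() p.2.

Fixpoint Ck (n : nat) F : Prop :=
  if n is n'.+1 then
    [/\ continuous F,
        (forall t x, derivable (fun t' => F (t', x)) t 1),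
        (forall t x, derivable (fun x' => F (t, x')) x 1),
        Ck n' (partial_t F) & Ck n' (partial_x F)]
  else continuous F.

Definition test_function F : Prop :=
  (forall n, Ck n F) /\ compact (closure [set p | F p != 0]).

End TestFunctions.

Section WeakFormulation.
Context {R : realType}.
Implicit Types u ux F : R * R -> R.

Local Notation mu1 := (@lebesgue_measure R).
Local Notation mu2 := (@lebesgue_measure R \x @lebesgue_measure R)%E.
Local Notation plane := (measurableTypeR R * measurableTypeR R)%type.

(* The library's [locally_integrable] only covers functions on the line. *)
Definition locally_integrable2 F : Prop :=
  measurable_fun [set: plane] F /\
  forall K : set (R * R), compact K -> (\int[mu2]_(p in K) `|F p|%:E < +oo)%E.

Definition weak_partial_x u ux : Prop :=
  [/\ locally_integrable2 u, locally_integrable2 ux &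
      forall Phi, test_function Phi ->
        (\int[mu2]_p (u p * partial_x Phi p)%:E =
         - \int[mu2]_p (ux p * Phi p)%:E)%E].

Definition P_integrand u ux (t x : R) : R -> R := fun z =>
  2^-1 * expR (- `|x - z|) * (u (t, z) ^+ 2 + 2^-1 * ux (t, z) ^+ 2).

Definition P u ux : R * R -> R := fun p =>
  \int[mu1]_(z in [set: R]) P_integrand u ux p.1 p.2 z.

Definition density u ux : R * R -> R := fun p => u p ^+ 2 + ux p ^+ 2.

Definition flux u ux : R * R -> R := fun p =>
  u p * (u p ^+ 2 + ux p ^+ 2) - u p ^+ 3 + 2 * P u ux p * u p.

(* [ux] is the weak derivative of [u] in x, and every integral occurring in
   the weak formulation converges; [ux] is only determined almost everywhere,
   so P is required to converge for almost every t. *)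
Definition has_weak_formulation u ux : Prop :=
  [/\ weak_partial_x u ux,
      {ae mu1, forall t, forall x,
         mu1.-integrable [set: R] (EFin \o P_integrand u ux t x)},
      locally_integrable2 (density u ux) &
      locally_integrable2 (flux u ux)].

Definition satisfies_weakly u : Prop :=
  exists2 ux, has_weak_formulation u ux &
    forall Phi, test_function Phi ->
      (\int[mu2]_p (density u ux p * partial_t Phi p
                    + flux u ux p * partial_x Phi p)%:E = 0)%E.

End WeakFormulation.

Section TravellingWaves.
Context {R : realType}.
Implicit Types (M s m L l : R) (phi psi : R -> R) (u : R * R -> R).

Definition cuspon_parameters M s m : Prop :=
  let z := s - M - m in
  [/\ z < m, m < s & s < M] \/ [/\ m < z, s < m & M < s].

Definition off_cusps L (x : R) : Prop := forall k : int, x != 2 * L * k%:~R.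

Definition cuspon_profile M s m L phi : Prop :=
  let z := s - M - m in
  0 < L /\ continuous phi /\ periodic phi (2 * L) /\
  (forall n x, off_cusps L x -> derivable (derive1n n phi) x 1) /\
  (forall x, off_cusps L x ->
     derive1 phi x ^+ 2 = (M - phi x) * (phi x - m) * (phi x - z) / (s - phi x)) /\
  (forall x, phi (- x) = phi x) /\
  phi 0 = s /\ phi L = m /\ derive1 phi L = 0 /\
  (m < s -> forall x, 0 < x < L -> derive1 phi x < 0) /\
  (s < m -> forall x, 0 < x < L -> 0 < derive1 phi x).

Definition stumpon_profile s L l phi psi : Prop :=
  [/\ periodic psi (2 * (L + l)),
      (forall x, `|x| < l -> psi x = s) &
      (forall x, l <= `|x| <= l + L -> psi x = phi (`|x| - l))].

Definition travelling_wave (f : R -> R) (x0 s : R) : R * R -> R :=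
  fun p => f (p.2 - x0 - s * p.1).

Definition periodic_cuspon u : Prop :=
  exists M s m L phi x0,
    [/\ cuspon_parameters M s m,
        cuspon_profile M s m L phi &
        u = travelling_wave phi x0 s].

Definition periodic_stumpon u : Prop :=
  exists M s m L phi l psi x0,
    [/\ cuspon_parameters M s m /\
          - (M * m) - (M + m) * (s - M - m) = s ^+ 2,
        cuspon_profile M s m L phi,
        0 < l,
        stumpon_profile s L l phi psi &
        u = travelling_wave psi x0 s].

End TravellingWaves.

(* Main.v *)
Require Import Defs.
From HB Require Import structures.
From mathcomp Require Import all_boot all_order all_algebra.
From mathcomp Require Import all_classical all_reals all_analysis.
From mathcomp Require Import measurable_realfun ring lra.

(** Both assertions follow from a computation on the profile f of a wave
    u = f(xi), xi = x - x0 - s t.  Put z = s - M - m, B = M m + (M + m) z and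
    Q(y) = (M - y)(y - m)(y - z), so that M + m + z = s.

    On the smooth arcs (s - f) f'^2 = Q(f).  Differentiating this and dividing by
    2 f' shows that r = (s - f) f' satisfies r' = q - f^2 - f'^2 / 2, where
    q = s f - f^2 / 2 - B / 2; moreover q' = r.  Hence q - q'' = f^2 + f'^2 / 2 on
    the arcs.  Since r^2 = (s - f) Q(f) vanishes at the cusps, r is continuous on
    the whole line, no Dirac mass appears in q'', and q is the bounded solution of
    the equation for P: the pressure of the wave is q(xi)
    ([integral_pressure_kernel]).  On a plateau f = s, the equation q = f^2 reads
    B = - s^2, which is the relation imposed on the parameters of a stumpon; so
    the same formula for P holds for stumpons ([stumpon_wave_profile]).

    In the moving frame the conservation law says that the defect, flux minus
    s times density, has zero distributional derivative
    ([weak_equation_flux_defect]).  Inserting P = q, the defect is the constant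
    - M m z on every arc ([flux_defect_arch]), which settles the cuspons, and the
    constant s^3 on every plateau ([flux_defect_plateau]).  For a stumpon the two
    values differ by Q(s), which is not zero, and a test function concentrated
    near an end of a plateau detects the jump ([stumpon_not_satisfies_weakly]).
    The weak derivative in that argument is an arbitrary one: it agrees almost
    everywhere with the explicit one ([weak_partial_x_unique]), because products
    of bump functions separate locally integrable functions.

    The derivative f' is unbounded at a cusp.  All integrals across cusps are
    evaluated by a fundamental theorem of calculus that tolerates finitely many
    exceptional points ([singular_ftc]); in its version for nonnegative
    derivatives it also proves that f'^2 is locally integrable, from the
    continuity of r alone. *)
Set Implicit Arguments.
Unset Strict Implicit.
Unset Printing Implicit Defensive.
Import Order.TTheory GRing.Theory Num.Theory.
Import numFieldNormedType.Exports.
Local Open Scope ring_scope.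
Local Open Scope classical_set_scope.

(** * Derivatives of real functions *)

Section Calculus.
Context {R : realType}.
Implicit Types (f g : R -> R) (x a b c k : R).

Lemma is_deriveR_eq f x a b : is_derive x 1 f a -> a = b -> is_derive x 1 f b.
Proof. by move=> ? <-. Qed.

Lemma is_deriveR_cst c x : is_derive x 1 (fun _ : R => c) 0.
Proof. exact: is_derive_cst. Qed.

Lemma is_deriveR_id x : is_derive x 1 (fun y : R => y) 1.
Proof. exact: is_derive_id. Qed.

Lemma is_deriveR_D f g x a b : is_derive x 1 f a -> is_derive x 1 g b ->
  is_derive x 1 (fun y => f y + g y) (a + b).
Proof. by move=> fa gb; apply: is_deriveD. Qed.

Lemma is_deriveR_N f x a : is_derive x 1 f a ->
  is_derive x 1 (fun y => - f y) (- a).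
Proof. by move=> fa; apply: is_deriveN. Qed.

Lemma is_deriveR_B f g x a b : is_derive x 1 f a -> is_derive x 1 g b ->
  is_derive x 1 (fun y => f y - g y) (a - b).
Proof. by move=> fa gb; apply: is_deriveB. Qed.

Lemma is_deriveR_M f g x a b : is_derive x 1 f a -> is_derive x 1 g b ->
  is_derive x 1 (fun y => f y * g y) (a * g x + f x * b).
Proof.
move=> fa gb; apply: is_deriveR_eq (is_deriveM fa gb) _.
by rewrite addrC [_ *: a]mulrC.
Qed.

Lemma is_deriveR_Z k f x a : is_derive x 1 f a ->
  is_derive x 1 (fun y => k * f y) (k * a).
Proof.
move=> fa; apply: is_deriveR_eq (is_deriveR_M (is_deriveR_cst k x) fa) _.
by rewrite mul0r add0r.
Qed.

Lemma is_deriveR_comp f g x a b :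
  is_derive (g x) 1 f a -> is_derive x 1 g b ->
  is_derive x 1 (fun y => f (g y)) (a * b).
Proof. exact: is_derive1_comp. Qed.

Lemma is_deriveR_shift f x c a : is_derive (x - c) 1 f a ->
  is_derive x 1 (fun y => f (y - c)) a.
Proof.
move=> fa; have dg := is_deriveR_B (is_deriveR_id x) (is_deriveR_cst c x).
by have := @is_deriveR_comp f (fun y => y - c) x _ _ fa dg; rewrite subr0 mulr1.
Qed.

Lemma is_deriveR_affine c k x : is_derive x 1 (fun y => c + k * y) k.
Proof.
apply: is_deriveR_eq
  (is_deriveR_D (is_deriveR_cst c x) (is_deriveR_Z k (is_deriveR_id x))) _.
by rewrite add0r mulr1.
Qed.

Lemma is_deriveR_near f g x a : (\forall y \near x, f y = g y) ->
  is_derive x 1 f a -> is_derive x 1 g a.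
Proof. by move=> fg; apply: near_eq_is_derive => //; exact: oner_neq0. Qed.

Lemma continuous_at_near f g x : (\forall y \near x, f y = g y) ->
  {for x, continuous f} -> {for x, continuous g}.
Proof.
move=> fg cf; have fgx : f x = g x by exact: (nbhs_singleton fg).
rewrite /prop_for /continuous_at -fgx.
by apply: cvg_trans cf; exact: near_eq_cvg.
Qed.

Lemma is_deriveR_continuous f x a :
  is_derive x 1 f a -> {for x, continuous f}.
Proof. by move=> [df _]; exact/differentiable_continuous/derivable1_diffP. Qed.

Lemma is_derive1 f x : derivable f x 1 -> is_derive x 1 f (derive1 f x).
Proof. by move=> df; apply: DeriveDef => //; rewrite derive1E. Qed.

Lemma is_derive_derive1 f x a : is_derive x 1 f a -> derive1 f x = a.
Proof. by move=> [_ <-]; rewrite derive1E. Qed.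

End Calculus.

(** * The fundamental theorem of calculus with exceptional points *)

(** For an integrable function, monotone convergence applies to the positive and
    to the negative part. *)
Lemma integral_nondecreasing_set_cvg d (T : measurableType d) (R : realType)
    (mu : {measure set T -> \bar R}) (F : (set T)^nat) (f : T -> \bar R) :
  nondecreasing_seq F -> (forall i, measurable (F i)) ->
  measurable_fun (\bigcup_i F i) f ->
  (forall x, (\bigcup_i F i) x -> (0 <= f x)%E) \/
    mu.-integrable (\bigcup_i F i) f ->
  (\int[mu]_(x in F i) f x)%E @[i --> \oo] -->
    (\int[mu]_(x in \bigcup_i F i) f x)%E.
Proof.
move=> ndF mF mf.
have mf_ i : measurable_fun (F i) f.
  apply: measurable_funS mf; first exact: bigcupT_measurable.
  exact: bigcup_sup.
move=> [f0|fi].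
  apply: ge0_nondecreasing_set_cvg_integral => // i x Fx; apply: f0.
  by exists i.
rewrite [X in _ --> X]integralE.
under eq_fun do rewrite integralE.
apply: cvgeB.
- apply: fin_num_adde_defr; apply: integrable_pos_fin_num => //.
  exact: bigcupT_measurable.
- apply: ge0_nondecreasing_set_cvg_integral => // i.
  exact: measurable_funepos.
- apply: ge0_nondecreasing_set_cvg_integral => // i.
  exact: measurable_funeneg.
Qed.

Section SingularFTC.
Context {R : realType}.
Local Notation mu := (@lebesgue_measure R).
Implicit Types (G g : R -> R) (a b c x : R) (s : seq R).

Definition continuous_derivative_at G g x :=
  is_derive x 1 G (g x) /\ {for x, continuous g}.

(** The classical theorem applies on [a + e, b - e], away from the singular ends,
    and the continuity of G gives the limit e -> 0.  For g >= 0 the limit of the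
    integrals exists by monotone convergence, so that the integrability of g is a
    consequence. *)
Lemma ftc_open_interval G g a b : a < b -> continuous G ->
  measurable_fun [set: R] g ->
  (forall x, 0 <= g x) \/ mu.-integrable `[a, b] (EFin \o g) ->
  (forall x, a < x < b -> continuous_derivative_at G g x) ->
  (\int[mu]_(x in `[a, b]) (g x)%:E)%E = (G b - G a)%:E.
Proof.
move=> ab cG mg gH dG.
have mgE A : measurable_fun A (EFin \o g).
  by apply: measurable_funTS; exact/measurable_EFinP.
rewrite integral_itv_bndoo; last exact: mgE.
(* at most a third of the length, so that a + e n < b - e n for every n *)
pose e n : R := (b - a) * (n.+3%:R)^-1.
have e0 n : 0 < e n by rewrite mulr_gt0// ?invr_gt0// subr_gt0.
have e3 n : e n <= (b - a) / 3.
  rewrite ler_pM2l ?subr_gt0// lef_pV2 ?posrE// ler_nat.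
  by [].
have el m n : (m <= n)%N -> e n <= e m.
  move=> mn; rewrite ler_pM2l ?subr_gt0// lef_pV2 ?posrE// ler_nat.
  by rewrite !ltnS.
have ecvg : e n @[n --> \oo] --> 0.
  rewrite -[X in _ --> X](mulr0 (b - a)); apply: cvgMr.
  have := @cvg_harmonic R; rewrite -(cvg_shiftn 2) /=.
  by under eq_fun do rewrite addn2.
pose F n := `[a + e n, b - e n]%classic.
have FE : `]a, b[%classic = \bigcup_n F n.
  apply/seteqP; split => x /=; rewrite in_itv/=.
    move=> /andP[ax xb].
    have : \forall n \near \oo, e n < Num.min (x - a) (b - x).
      by apply: (cvgr_lt 0) => //; rewrite lt_min !subr_gt0 ax.
    case => n _ /(_ n (leqnn _)) /=; rewrite lt_min => /andP[h1 h2].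
    exists n => //; rewrite /F/= in_itv/=; apply/andP; split; lra.
  move=> [n _]; rewrite /F/= in_itv/= => /andP[]; have := e0 n; lra.
have ndF : nondecreasing_seq F.
  move=> m n mn; rewrite subsetEset => x; rewrite /F/= !in_itv/=.
  move=> /andP[]; have := el _ _ mn; lra.
have mF i : measurable (F i) by exact: measurable_itv.
have : (\int[mu]_(x in F i) (g x)%:E)%E @[i --> \oo] -->
    (\int[mu]_(x in `]a, b[) (g x)%:E)%E.
  rewrite FE; apply: integral_nondecreasing_set_cvg => //; first exact: mgE.
  case: gH => [g0|gi]; [left => x _; rewrite lee_fin//|right].
  rewrite -FE; apply: integrableS gi => //.
  exact: subset_itv_oo_cc.
move/cvg_unique; apply; first exact: ereal_hausdorff.
have -> : (fun i => (\int[mu]_(x in F i) (g x)%:E)%E) =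
    (fun i => (G (b - e i) - G (a + e i))%:E).
  apply/funext => n; rewrite EFinB; apply: continuous_FTC2.
  - have := e3 n; have := e0 n; lra.
  - apply: continuous_in_subspaceT => x; rewrite inE /= in_itv/= => /andP[h1 h2].
    apply: (dG _ _).2; have := e0 n; lra.
  - split.
    + move=> x; rewrite in_itv/= => /andP[h1 h2].
      have [|[? _] _] := dG x; first by have := e0 n; lra.
      by [].
    + by apply: cvg_at_right_filter; exact: cG.
    + by apply: cvg_at_left_filter; exact: cG.
  - move=> x; rewrite in_itv/= => /andP[h1 h2].
    have [|? _] := dG x; first by have := e0 n; lra.
    by rewrite derive1E derive_val.
apply: cvg_EFin; first by near=> n.
rewrite /comp /=; apply: cvgB.
  apply: continuous_cvg; first exact: cG.
  rewrite -[X in _ --> X]subr0; apply: cvgB => //; exact: cvg_cst.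
apply: continuous_cvg; first exact: cG.
rewrite -[X in _ --> X]addr0; apply: cvgD => //; exact: cvg_cst.
Unshelve. all: by end_near. Qed.

(** The interval is cut at the exceptional points; since G is continuous there, the
    boundary terms telescope. *)
Lemma singular_ftc G g s a b : a <= b -> continuous G ->
  measurable_fun [set: R] g ->
  (forall x, 0 <= g x) \/ mu.-integrable `[a, b] (EFin \o g) ->
  (forall x, a < x < b -> x \notin s -> continuous_derivative_at G g x) ->
  (\int[mu]_(x in `[a, b]) (g x)%:E)%E = (G b - G a)%:E.
Proof.
move=> ab cG mg; elim: s a b ab => [|c s IH] a b.
  rewrite le_eqVlt => /predU1P[<- _ _|ab gH dG].
    by rewrite set_itv1 integral_set1 subrr.
  by apply: ftc_open_interval => // x xab; exact: dG.
move=> ab gH dG.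
have [/andP[ac cb]|cab] := boolP (a < c < b); last first.
  apply: IH => // x xab xs; apply: dG => //; rewrite inE negb_or xs andbT.
  by apply: contraNneq cab => <-.
have mgE A : measurable_fun A (EFin \o g).
  by apply: measurable_funTS; exact/measurable_EFinP.
have HI a' b' : a <= a' -> b' <= b ->
    (forall x, 0 <= g x) \/ mu.-integrable `[a', b'] (EFin \o g).
  move=> aa bb; case: gH => [|gi]; [by left|right].
  by apply: integrableS gi => //; apply: subset_itv; rewrite bnd_simp.
rewrite (@itv_bndbnd_setU _ _ _ (BRight c)); [|by rewrite bnd_simp ltW..].
rewrite integral_setU //=; [|exact: mgE|]; last first.
  by apply: lt_disjoint => x y; rewrite !in_itv/= => /andP[_ xc] /andP[cy _]; apply: le_lt_trans cy.
rewrite integral_itv_obnd_cbnd; last exact: mgE.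
rewrite !IH ?ltW//.
- by rewrite -EFinD; congr EFin; lra.
- by apply: HI => //; exact: ltW.
- move=> x /andP[cx xb] xs; apply: dG; first by rewrite cx (lt_trans xb).
  by rewrite inE negb_or xs andbT lt_eqF.
- by apply: HI => //; exact: ltW.
- move=> x /andP[cx xb] xs; apply: dG; first by rewrite (lt_trans ac).
  by rewrite inE negb_or xs andbT gt_eqF.
Qed.

End SingularFTC.

(** * Measurability, translations and squares *)

Section Plane.
Context {R : realType}.
Local Notation mu := (@lebesgue_measure R).
Local Notation plane := (measurableTypeR R * measurableTypeR R)%type.
Local Notation mu2 := (@lebesgue_measure R \x @lebesgue_measure R)%E.

(** Squares with rational centre and size form a countable basis, and the product
    sigma-algebra contains them. *)
Lemma open_measurable_plane (U : set (R * R)) :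
  open U -> measurable (U : set plane).
Proof.
move=> oU.
pose sq (q : rat * rat * rat) : set (R * R) :=
  ball (ratr q.1.1 : R) (ratr q.2) `*` ball (ratr q.1.2 : R) (ratr q.2).
have -> : U = \bigcup_(q in [set: rat * rat * rat])
    [set p | sq q `<=` U /\ sq q p].
  apply/seteqP; split => [p Up|p [q _ [qU qp]]]; last exact: qU.
  have /nbhs_ballP[e /= e0 eU] : nbhs p U by exact: open_nbhs_nbhs.
  have [r] := @rat_in_itvoo R 0 (e / 2) (divr_gt0 e0 (ltr0Sn _ _)).
  rewrite in_itv/= => /andP[r0 re].
  have [|a] := @rat_in_itvoo R (p.1 - ratr r) (p.1 + ratr r); first by lra.
  rewrite in_itv/= => /andP[a1 a2].
  have [|b] := @rat_in_itvoo R (p.2 - ratr r) (p.2 + ratr r); first by lra.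
  rewrite in_itv/= => /andP[b1 b2].
  exists (a, b, r) => //; split; last first.
    by split; rewrite /ball/= ltr_norml; apply/andP; split; lra.
  move=> y [/= y1 y2]; apply: eU.
  move: y1 y2; rewrite /ball/= !ltr_norml => /andP[y1 y1'] /andP[y2 y2'].
  by split; rewrite /ball/= ltr_norml; apply/andP; split; lra.
apply: countable_bigcupT_measurable; first exact: countableP.
move=> q; have [qU|qU] := pselect (sq q `<=` U); last first.
  by rewrite (_ : [set _ | _] = set0)//; apply/seteqP; split => // p [].
rewrite (_ : [set _ | _] = sq q); last by apply/seteqP; split => // p [].
by apply: measurableX; exact: measurable_ball.
Qed.

Lemma continuous_measurable_plane (F : R * R -> R) :
  continuous F -> measurable_fun [set: plane] F.
Proof.
move=> /continuousP cF; apply: (measurability _ (RGenOpens.measurableE R)).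
move=> _ [_ [a [b ->] <-]]; rewrite setTI; apply: open_measurable_plane.
exact/cF/interval_open.
Qed.

Lemma lebesgue_measure_translate (c : R) (A : set R) : measurable A ->
  pushforward mu ((fun x => x + c) : _ -> measurableTypeR R) A = mu A.
Proof.
have mt : measurable_fun setT ((fun x => x + c) : R -> measurableTypeR R).
  exact: measurable_funD.
move=> mA; apply/esym/lebesgue_measure_unique => //= _ [[a b]] _ <-.
rewrite /pushforward/=.
rewrite (_ : _ @^-1` _ = `]a - c, b - c]%classic); last first.
  by apply/seteqP; split => x /=; rewrite !in_itv/= ltrBlDr lerBrDr.
rewrite !lebesgue_measure_itv/= !lte_fin ltrD2r.
by case: ifPn => // _; rewrite -!EFinD; congr EFin; ring.
Qed.

Lemma ge0_integral_translate (c : R) (f : R -> \bar R) :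
  measurable_fun [set: R] f -> (forall x, 0 <= f x)%E ->
  (\int[mu]_x f (x + c)%R = \int[mu]_x f x)%E.
Proof.
move=> mf f0.
have mt : measurable_fun setT ((fun x => x + c) : R -> measurableTypeR R).
  exact: measurable_funD.
rewrite -(@ge0_integral_pushforward _ _ (measurableTypeR R) (measurableTypeR R)
  _ _ mt (@lebesgue_measure R) setT f measurableT mf (fun x _ => f0 x)).
by apply: eq_measure_integral => //= A mA _; exact: lebesgue_measure_translate.
Qed.

Lemma integral_translate (c : R) (f : R -> \bar R) :
  measurable_fun [set: R] f ->
  (\int[mu]_x f (x + c)%R = \int[mu]_x f x)%E.
Proof.
move=> mf; rewrite integralE [RHS]integralE.
rewrite -(ge0_integral_translate c (measurable_funepos mf))//.
rewrite -(ge0_integral_translate c (measurable_funeneg mf))//.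
by congr (_ - _)%E; apply: eq_integral => x _; rewrite ?funeposE ?funenegE.
Qed.

(** Compact support is measured by one number, so that all the slices of F vanish off
    the same interval. *)
Definition vanishes_off_square (N : R) (F : R * R -> R) :=
  forall p, N <= `|p.1| \/ N <= `|p.2| -> F p = 0.

Definition square (N : R) : set (R * R) := `[- N, N]%classic `*` `[- N, N]%classic.

Lemma compact_square N : compact (square N).
Proof. by apply: compact_setX; exact: segment_compact. Qed.

Lemma measurable_square N : measurable (square N : set plane).
Proof. by apply: measurableX; exact: measurable_itv. Qed.

Lemma compact_sub_square (K : set (R * R)) : compact K ->
  exists2 N, 0 < N & K `<=` square N.
Proof.
move=> /compact_bounded[M [_ MK]].
exists (`|M| + 1) => [|p Kp]; first by rewrite ltr_wpDl.
have MM : M < `|M| + 1 by rewrite (le_lt_trans (ler_norm _))// ltrDl.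
have /= := MK _ MM p Kp.
rewrite prod_normE/= ge_max => /andP[].
by rewrite /square/= !in_itv/= -!ler_norml.
Qed.

(** Every compact set lies in a square, and squares are compact. *)
Lemma locally_integrable2P (F : R * R -> R) : measurable_fun [set: plane] F ->
  locally_integrable2 F <->
  forall N, (\int[mu2]_(p in square N) `|F p|%:E < +oo)%E.
Proof.
move=> mF; split => [[_ +] N|FN]; first by apply; exact: compact_square.
split=> // K cK; have [N N0 KN] := compact_sub_square cK.
have mK : measurable (K : set plane).
  rewrite -(setCK K); apply: measurableC; apply: open_measurable_plane.
  by apply: closed_openC; apply: compact_closed => //; exact: norm_hausdorff.
apply: le_lt_trans (FN N); apply: ge0_subset_integral => //.
  exact: measurable_square.
by apply: measurable_funTS; apply/measurable_EFinP; exact: measurableT_comp.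
Qed.

End Plane.

(** * Local integrability *)

Section LocallyIntegrable.
Context {R : realType}.
Local Notation mu := (@lebesgue_measure R).
Local Notation plane := (measurableTypeR R * measurableTypeR R)%type.
Local Notation mu2 := (@lebesgue_measure R \x @lebesgue_measure R)%E.

Definition locally_integrable1 (g : R -> R) :=
  forall a b, mu.-integrable `[a, b] (EFin \o g).

Lemma locally_integrable1_bounded_mul (g h : R -> R) (C : R) :
  locally_integrable1 g -> measurable_fun [set: R] h ->
  (forall x, `|h x| <= C) -> locally_integrable1 (fun x => g x * h x).
Proof.
move=> gi mh hC a b.
have C0 : 0 <= C by apply: le_trans (hC 0); exact: normr_ge0.
have mg : measurable_fun `[a, b] g.
  by apply/measurable_EFinP; case/integrableP: (gi a b).
apply: (@le_integrable _ _ _ mu _ _ _ (fun x => (C%:E * (g x)%:E)%E)) => //=.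
- apply/measurable_EFinP/measurable_funM => //.
  exact: measurable_funTS.
- move=> x _; rewrite lee_fin !normrM mulrC (ger0_norm C0).
  by rewrite ler_wpM2r.
- exact: integrableZl.
Qed.

Lemma locally_integrable1_le (g h : R -> R) : measurable_fun [set: R] g ->
  (forall x, `|g x| <= h x) -> locally_integrable1 h -> locally_integrable1 g.
Proof.
move=> mg gh hi a b; apply: (le_integrable _ _ _ (hi a b)) => //.
  by apply: measurable_funTS; exact/measurable_EFinP.
by move=> x _ /=; rewrite lee_fin (le_trans (gh x))// ler_norm.
Qed.

Lemma locally_integrable1D (g h : R -> R) :
  locally_integrable1 g -> locally_integrable1 h ->
  locally_integrable1 (fun x => g x + h x).
Proof.
move=> gi hi a b.
rewrite (_ : _ \o _ = (EFin \o g) \+ (EFin \o h))%E//.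
exact: integrableD.
Qed.

Lemma locally_integrable1_continuous (g : R -> R) :
  continuous g -> locally_integrable1 g.
Proof.
move=> cg a b; apply: continuous_compact_integrable; first exact: segment_compact.
exact: continuous_subspaceT.
Qed.

Lemma continuous_segment_bounded (k : R -> R) a b : continuous k ->
  exists2 C, 0 <= C & forall x, a <= x <= b -> `|k x| <= C.
Proof.
move=> ck; have : compact (k @` `[a, b]).
  by apply: continuous_compact; [exact: continuous_subspaceT|exact: segment_compact].
move=> /compact_bounded[M [_ MK]].
have MM : M < `|M| + 1 by rewrite (le_lt_trans (ler_norm _))// ltrDl.
exists (`|M| + 1) => [|x xab]; first by rewrite addr_ge0.
by apply: (MK _ MM); exists x => //=; rewrite in_itv.
Qed.

Lemma integral_vanishing (g : R -> R) (N : R) :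
  (forall x, N <= `|x| -> g x = 0) ->
  (\int[mu]_x (g x)%:E)%E = (\int[mu]_(x in `[(- N)%R, N]) (g x)%:E)%E.
Proof.
move=> g0; rewrite [RHS]integral_mkcond; apply: eq_integral => x _.
rewrite /patch; case: ifPn => // /negP; rewrite inE/= in_itv/= -ler_norml.
by move/negP; rewrite -ltNge => /ltW/g0 ->.
Qed.

Lemma integral_derivative_vanishing (G g : R -> R) (N : R) (s : seq R) :
  0 <= N -> continuous G -> measurable_fun [set: R] g ->
  (forall x, N <= `|x| -> G x = 0) -> (forall x, N <= `|x| -> g x = 0) ->
  mu.-integrable `[- N, N] (EFin \o g) ->
  (forall x, - N < x < N -> x \notin s -> continuous_derivative_at G g x) ->
  (\int[mu]_x (g x)%:E = 0)%E.
Proof.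
move=> N0 cG mg G0 g0 gi dG; rewrite (integral_vanishing g0).
rewrite (@singular_ftc _ G g s) //; [|by lra|by right].
by rewrite !G0 ?normrN ?ler_norm// subrr.
Qed.

Lemma vanishes_out_of_square (F : R * R -> R) N p :
  vanishes_off_square N F -> ~ square N p -> F p = 0.
Proof.
move=> F0 pN; apply: F0.
have [|h1] := leP N `|p.1|; first by left.
have [|h2] := leP N `|p.2|; first by right.
exfalso; apply: pN; rewrite /square/= !in_itv/= -!ler_norml.
by split; exact: ltW.
Qed.

Lemma vanishing_bounded (F : R * R -> R) N :
  continuous F -> vanishes_off_square N F ->
  exists2 C, 0 <= C & forall p, `|F p| <= C.
Proof.
move=> cF F0.
have : compact (F @` square N).
  by apply: continuous_compact; [exact: continuous_subspaceT|exact: compact_square].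
move=> /compact_bounded[M [_ MK]].
have MM : M < `|M| + 1 by rewrite (le_lt_trans (ler_norm _))// ltrDl.
exists (`|M| + 1) => [|p]; first by rewrite addr_ge0.
have [pN|/(vanishes_out_of_square F0) ->] := pselect (square N p).
  by apply: (MK _ MM); exists p.
by rewrite normr0 addr_ge0.
Qed.

(** The continuous factor is bounded, and vanishes off a square over which h is
    integrable. *)
Lemma integrable_mul_vanishing (h F : R * R -> R) N :
  locally_integrable2 h -> continuous F -> vanishes_off_square N F ->
  mu2.-integrable [set: plane] (fun p => (h p * F p)%:E).
Proof.
move=> [mh hi] cF F0; have [C C0 FC] := vanishing_bounded cF F0.
have mF : measurable_fun [set: plane] F by exact: continuous_measurable_plane.
apply/integrableP; split.
  by apply/measurable_EFinP; exact: measurable_funM.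
have mah : measurable_fun [set: plane] (fun p => `|h p|%:E).
  by apply/measurable_EFinP; exact: measurableT_comp.
apply: (@le_lt_trans _ _ (\int[mu2]_(p in square N) (C%:E * `|h p|%:E))%E).
  rewrite [leRHS]integral_mkcond; apply: ge0_le_integral => //.
  - by apply: measurableT_comp => //; apply/measurable_EFinP; exact: measurable_funM.
  - apply/(measurable_restrictT _ _).1; first exact: measurable_square.
    by apply: measurable_funTS; apply: emeasurable_funM.
  - move=> p _; rewrite /patch; case: ifPn => [_|].
      by rewrite -EFinM lee_fin normrM mulrC ler_wpM2r.
    move=> /negP; rewrite inE => /(vanishes_out_of_square F0) ->.
    by rewrite mulr0 abse0.
rewrite ge0_integralZl//.
- by rewrite lte_mul_pinfty// hi//; exact: compact_square.
- exact: measurable_square.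
- exact: measurable_funTS.
Qed.

Lemma locally_integrable1_measurable (g : R -> R) :
  locally_integrable1 g -> measurable_fun [set: R] g.
Proof.
move=> gi.
rewrite (_ : [set: R] = \bigcup_n `[- n%:R, n%:R]%classic).
  apply/measurable_fun_bigcup => n; first exact: measurable_itv.
  by apply/measurable_EFinP; case/integrableP: (gi (- n%:R) n%:R).
apply/seteqP; split => // x _.
exists (Num.truncn `|x|).+1 => //=; rewrite in_itv/= -ler_norml.
by rewrite ltW// truncnS_gt.
Qed.

Lemma travelling_wave_measurable (g : R -> R) (x0 s : R) :
  measurable_fun [set: R] g ->
  measurable_fun [set: plane] (travelling_wave g x0 s).
Proof.
move=> mg; apply: measurableT_comp => //.
apply: continuous_measurable_plane => p.
apply: cvgB; first by apply: cvgB; [exact: cvg_snd|exact: cvg_cst].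
by apply: cvgMr; exact: cvg_fst.
Qed.

(** On a square the coordinate x - x0 - s t stays in a fixed segment [- M, M], so by
    translation invariance every time slice has an integral of at most that of |g|
    over this segment. *)
Lemma travelling_wave_locally_integrable (g : R -> R) (x0 s : R) :
  locally_integrable1 g -> locally_integrable2 (travelling_wave g x0 s).
Proof.
move=> gi; have mg := locally_integrable1_measurable gi.
have mtg := travelling_wave_measurable x0 s mg.
apply/locally_integrable2P => // N.
have mag : measurable_fun [set: plane] (fun p => `|travelling_wave g x0 s p|%:E).
  by apply/measurable_EFinP; exact: measurableT_comp.
pose M := `|N| + `|x0| + `|s| * `|N|.
pose I := (\int[mu]_(x in `[(- M)%R, M]) `|g x|%:E)%E.
have Ioo : (I < +oo)%E by have /integrableP[] := gi (- M) M.
have mM : measurable_fun [set: R] ((fun y => `|g y|%:E) \_ `[- M, M]).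
  apply/(measurable_restrictT _ _).1 => //.
  by apply/measurable_funTS/measurable_EFinP; exact: measurableT_comp.
rewrite integral_mkcond fubini_tonelli1; last 2 first.
- apply/(measurable_restrictT _ _).1; first exact: measurable_square.
  exact: measurable_funTS.
- by move=> p; apply: erestrict_ge0 => q _; rewrite lee_fin.
apply: (@le_lt_trans _ _ (\int[mu]_(t in `[(- N)%R, N]) (cst I t))%E); last first.
  rewrite integral_cst//= lebesgue_measure_itv/=.
  rewrite lte_mul_pinfty//; first exact: integral_ge0.
    by rewrite fin_numElt Ioo (lt_le_trans _ (integral_ge0 _ _)).
  by case: ifP => // _; rewrite -EFinD ltry.
rewrite [leRHS]integral_mkcond; apply: ge0_le_integral => //.
- by move=> t _; apply: integral_ge0 => x _; apply: erestrict_ge0 => q _; rewrite lee_fin.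
- apply: measurable_fun_fubini_tonelli_F.
    apply/(measurable_restrictT _ _).1; first exact: measurable_square.
    exact: measurable_funTS.
  by move=> p; apply: erestrict_ge0 => q _; rewrite lee_fin.
- by apply/(measurable_restrictT _ _).1 => //; exact: measurable_cst.
move=> t _; rewrite /fubini_F [leRHS]/patch; case: ifPn => [|/negP]; rewrite inE/= => tN; last first.
  rewrite integral0_eq// => x _; rewrite patchE ifF//.
  by apply/negP; rewrite inE /square => -[].
rewrite /I [leRHS]integral_mkcond.
rewrite -[leRHS](@ge0_integral_translate _ (- x0 - s * t)) //; last first.
  by move=> x; apply: erestrict_ge0 => q _; rewrite lee_fin.
apply: ge0_le_integral => //.
- by move=> x _; apply: erestrict_ge0 => q _; rewrite lee_fin.
- apply: (@measurableT_comp _ _ _ _ _ _ _ _ (fun x => (t, x))).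
    apply/(measurable_restrictT _ _).1; first exact: measurable_square.
    exact: measurable_funTS.
  exact: measurable_pair1.
- by apply: measurableT_comp => //; exact: measurable_funD.
move=> x _; rewrite /patch; case: ifPn; last first.
  by move=> _; case: ifPn => // _; rewrite lee_fin.
rewrite inE => -[/= _ xN]; rewrite mem_set; last first.
  move: tN xN; rewrite /= !in_itv/= -!ler_norml => tN xN.
  rewrite (le_trans (ler_normD _ _))// /M -addrA lerD//.
    by rewrite (le_trans xN)// ler_norm.
  rewrite (le_trans (ler_normB _ _))// normrN lerD// normrM ler_wpM2l//.
  by rewrite (le_trans tN)// ler_norm.
by rewrite /travelling_wave/= addrA.
Qed.

End LocallyIntegrable.

(** * Test functions *)

Section TestFunctions.
Context {R : realType}.
Local Notation mu := (@lebesgue_measure R).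
Local Notation plane := (measurableTypeR R * measurableTypeR R)%type.
Local Notation mu2 := (@lebesgue_measure R \x @lebesgue_measure R)%E.
Implicit Types F : R * R -> R.

Lemma continuous_slice_x F t : continuous F -> continuous (fun x => F (t, x)).
Proof.
move=> cF x; apply/cvgrPdist_lt => e e0.
have /cvgrPdist_lt/(_ e e0)/nbhs_ballP[d /= d0 dF] := cF (t, x).
near=> y; apply: (dF (t, y)); split; first exact: ballxx.
by near: y; apply/nbhs_ballP; exists d.
Unshelve. all: by end_near. Qed.

Lemma continuous_slice_t F x : continuous F -> continuous (fun t => F (t, x)).
Proof.
move=> cF t; apply/cvgrPdist_lt => e e0.
have /cvgrPdist_lt/(_ e e0)/nbhs_ballP[d /= d0 dF] := cF (t, x).
near=> y; apply: (dF (y, x)); split; last exact: ballxx.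
by near: y; apply/nbhs_ballP; exists d.
Unshelve. all: by end_near. Qed.

Lemma cvg_is_derive (f : R -> R) x l :
  h^-1 * (f (h + x) - f x) @[h --> 0^'] --> l -> is_derive x 1 f l.
Proof.
move=> H.
have H' : h^-1 *: ((f \o shift x) (h *: 1) - f x) @[h --> 0^'] --> l.
  by under eq_fun do rewrite /= [_ *: 1]mulr1.
apply: DeriveDef; first by apply/cvg_ex; exists l.
exact/cvg_lim.
Qed.

(** The increment h may have either sign. *)
Lemma mean_value (f f' : R -> R) (a h : R) :
  (forall x : R, is_derive x 1 f (f' x)) ->
  exists2 c, `|c - a| <= `|h| & f (a + h) - f a = f' c * h.
Proof.
move=> df.
have cf : continuous f.
  by move=> x; exact: is_deriveR_continuous.
have [h0|h0] := leP 0 h.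
  have [||c] := @MVT_segment R f f' a (a + h); rewrite ?lerDl//.
    exact: continuous_subspaceT.
  rewrite in_itv/= => /andP[ac ca] ->; exists c; last by congr (_ * _); lra.
  by rewrite !ger0_norm//; lra.
have [||c] := @MVT_segment R f f' (a + h) a; rewrite ?gerDl ?ltW//.
  exact: continuous_subspaceT.
rewrite in_itv/= => /andP[ac ca] E; exists c; last by lra.
by rewrite ler0_norm ?ltr0_norm//; lra.
Qed.

(** The increment is split into one in t and one in x.  The increment in t is taken at
    a moving value of x, for which the mean value theorem and the continuity of the
    partial derivative are used. *)
Lemma is_derive_along_line F (s c t : R) : Ck 1 F ->
  is_derive t 1 (fun t => F (t, c + s * t))
    (partial_t F (t, c + s * t) + s * partial_x F (t, c + s * t)).
Proof.
move=> [cF dFt dFx cFt cFx]; rewrite /= in cFt cFx.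
set x := c + s * t.
apply: cvg_is_derive.
have dt (y t' : R) : is_derive t' 1 (fun t => F (t, y)) (partial_t F (t', y)).
  exact: is_derive1.
have dx : is_derive x 1 (fun x => F (t, x)) (partial_x F (t, x)).
  exact: is_derive1.
have dl : is_derive t 1 (fun t' => F (t, c + s * t')) (s * partial_x F (t, x)).
  rewrite [s * partial_x _ _]mulrC.
  exact: (@is_deriveR_comp _ (fun x => F (t, x)) (fun y => c + s * y) t _ _ dx
    (is_deriveR_affine c s t)).
have ql : h^-1 * (F (t, c + s * (h + t)) - F (t, x)) @[h --> 0^'] -->
    s * partial_x F (t, x).
  have [/cvg_ex[l hl] dE] := dl.
  rewrite -dE /derive; have := hl; move/cvg_lim => -> //.
  by move: hl; under eq_fun do rewrite /= [_ *: 1]mulr1.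
have qt : h^-1 * (F (h + t, c + s * (h + t)) - F (t, c + s * (h + t)))
    @[h --> 0^'] --> partial_t F (t, x).
  apply/cvgrPdist_lt => e e0.
  have /cvgrPdist_lt/(_ e e0)/nbhs_ballP[d /= d0 dF] := cFt (t, x).
  pose d' := d / (`|s| + 1).
  have s1 : 0 < `|s| + 1 by rewrite ltr_wpDl.
  have d'0 : 0 < d' by rewrite divr_gt0.
  near=> h.
  have h0 : h != 0 by near: h; exact: nbhs_dnbhs_neq.
  have hd : `|h| < d'.
    near: h; apply: dnbhs0_lt => //.
  have hsd : (`|s| + 1) * `|h| < d by rewrite mulrC -ltr_pdivlMr.
  have [c' c't] := mean_value t h (dt (c + s * (h + t))).
  rewrite [h + t]addrC => ->; rewrite mulrC -mulrA divff// mulr1.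
  apply: (dF (c', _)); split; rewrite /ball/=.
    rewrite distrC (le_lt_trans c't)// (le_lt_trans _ hsd)// ler_peMl//.
    by rewrite lerDr.
  rewrite (_ : x - _ = - (s * h)); last by rewrite /x; ring.
  rewrite normrN normrM (le_lt_trans _ hsd)// ler_wpM2r//.
  by rewrite lerDl.
have -> : (fun h => h^-1 * (F (h + t, c + s * (h + t)) - F (t, c + s * t))) =
    (fun h => h^-1 * (F (h + t, c + s * (h + t)) - F (t, c + s * (h + t))) +
              h^-1 * (F (t, c + s * (h + t)) - F (t, x))).
  by apply/funext => h; rewrite -mulrDr addrA subrK.
exact: cvgD.
Unshelve. all: by end_near. Qed.

(** The margin 1 makes F vanish in a whole neighbourhood of the points considered. *)
Lemma partial_t_vanishes N F : vanishes_off_square N F ->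
  vanishes_off_square (N + 1) (partial_t F).
Proof.
move=> F0 [t x] /= H; rewrite /partial_t/= derive1E.
have -> : 'D_1 (fun t0 => F (t0, x)) t = 'D_1 (cst 0 : R -> R) t.
  apply: near_eq_derive.
  case: H => H; last first.
    by near=> t'; rewrite F0//; right => /=; lra.
  near=> t'; rewrite F0//; left => /=.
  have : `|t - t'| < 1 by near: t'; apply: cvgr_dist_lt => //; exact: cvg_id.
  have := lerB_dist t t'; lra.
exact: derive_cst.
Unshelve. all: by end_near. Qed.

Lemma partial_x_vanishes N F : vanishes_off_square N F ->
  vanishes_off_square (N + 1) (partial_x F).
Proof.
move=> F0 [t x] /= H; rewrite /partial_x/= derive1E.
have -> : 'D_1 (fun x0 => F (t, x0)) x = 'D_1 (cst 0 : R -> R) x.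
  apply: near_eq_derive.
  case: H => H.
    by near=> t'; rewrite F0//; left => /=; lra.
  near=> t'; rewrite F0//; right => /=.
  have : `|x - t'| < 1 by near: t'; apply: cvgr_dist_lt => //; exact: cvg_id.
  have := lerB_dist x t'; lra.
exact: derive_cst.
Unshelve. all: by end_near. Qed.

Lemma test_function_C1 F : test_function F ->
  exists2 N, 0 < N & [/\ Ck 1 F, vanishes_off_square N F,
    vanishes_off_square N (partial_t F) & vanishes_off_square N (partial_x F)].
Proof.
move=> [CkF /compact_sub_square[N N0 KN]].
have F0 : vanishes_off_square (N + 1) F.
  move=> p pN; apply/eqP; apply: contrapT => /negP Fp.
  have : square N p by apply: KN; exact: subset_closure.
  rewrite /square/= !in_itv/= -!ler_norml => -[]; lra.
exists (N + 1 + 1); first lra; split; [exact: CkF| | |].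
- by move=> p pN; apply: F0; lra.
- exact: partial_t_vanishes.
- exact: partial_x_vanishes.
Qed.

End TestFunctions.

(** * Integrals in the moving frame *)

Section TravellingWaves.
Context {R : realType}.
Local Notation mu := (@lebesgue_measure R).
Local Notation plane := (measurableTypeR R * measurableTypeR R)%type.
Local Notation mu2 := (@lebesgue_measure R \x @lebesgue_measure R)%E.
Implicit Types (f g : R -> R) (S : set R) (F Phi : R * R -> R).

Definition locally_finite S :=
  forall a b, exists s : seq R, forall x, a < x < b -> S x -> x \in s.

(** The continuity of f through S is what prevents jump terms: g is then the
    distributional derivative of f on the whole line. *)
Definition singular_derivative S f g :=
  [/\ continuous f, locally_integrable1 g, locally_finite S &
      forall x, ~ S x -> continuous_derivative_at f g x].

Lemma integral_slices_eq0 (h : R * R -> R) :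
  mu2.-integrable [set: plane] (fun p => (h p)%:E) ->
  (forall t, (\int[mu]_x (h (t, x))%:E = 0)%E) ->
  (\int[mu2]_p (h p)%:E = 0)%E.
Proof.
move=> hi h0; rewrite -(integral12_prod_meas1 hi).
by apply: integral0_eq => t _; exact: h0.
Qed.

Lemma vanishes_slice_x N F t x : vanishes_off_square N F ->
  N <= `|x| -> F (t, x) = 0.
Proof. by move=> F0 Nx; apply: F0; right. Qed.

Lemma locally_integrable1_shift g c : locally_integrable1 g ->
  locally_integrable1 (fun x => g (x - c)).
Proof.
move=> gi a b; have mg := locally_integrable1_measurable gi.
have ms : measurable_fun [set: R] (fun x : R => g (x - c)).
  by apply: measurableT_comp => //; exact: measurable_funB.
apply/integrableP; split; first exact/measurable_funTS/measurable_EFinP.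
have /integrableP[_] := gi (a - c) (b - c).
rewrite integral_mkcond [X in _ -> (X < _)%E]integral_mkcond.
rewrite -(@ge0_integral_translate _ (- c)).
- congr (_ < _)%E; apply: eq_integral => x _; rewrite /patch.
  rewrite (_ : ((x - c)%R \in `[a - c, b - c]%classic) = (x \in `[a, b]%classic))//.
  by apply/idP/idP; rewrite !inE/= !in_itv/= !lerD2r.
- apply/(measurable_restrictT _ _).1 => //.
  by apply/measurable_funTS; apply/measurable_EFinP; exact: measurableT_comp.
- by move=> x; apply: erestrict_ge0 => y _; rewrite lee_fin.
Qed.

Lemma singular_derivative_shift S f g c : singular_derivative S f g ->
  singular_derivative [set x | S (x - c)]
    (fun x => f (x - c)) (fun x => g (x - c)).
Proof.
have cs x : {for x, continuous (fun y : R => y - c)}.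
  by apply: cvgB; [exact: cvg_id|exact: cvg_cst].
move=> [cf gi lfS df]; split.
- by move=> x; apply: continuous_comp; [exact: cs|exact: cf].
- exact: locally_integrable1_shift.
- move=> a b; have [s sP] := lfS (a - c) (b - c).
  exists [seq x + c | x <- s] => x xab Sx.
  by apply/mapP; exists (x - c); [apply: sP => //; lra|rewrite subrK].
- move=> x Sx; have [dx cx] := df _ Sx; split.
    exact: is_deriveR_shift.
  by apply: continuous_comp; [exact: cs|exact: cx].
Qed.

(** The product f h has the singular derivative f h' + g h, and vanishes at both ends
    of [- N, N]. *)
Lemma singular_integration_by_parts S f g (h : R -> R) N :
  0 <= N -> singular_derivative S f g ->
  (forall x, derivable h x 1) -> continuous (derive1 h) ->
  (forall x, N <= `|x| -> h x = 0) -> (forall x, N <= `|x| -> derive1 h x = 0) ->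
  (\int[mu]_x (f x * derive1 h x + g x * h x)%:E = 0)%E.
Proof.
move=> N0 [cf gi lfS df] dh ch' h0 h'0.
have ch : continuous h by move=> x; exact: is_deriveR_continuous (is_derive1 (dh x)).
have mg := locally_integrable1_measurable gi.
have [s sP] := lfS (- N) N.
have mh := continuous_measurable_fun ch.
have mh' := continuous_measurable_fun ch'.
have mf := continuous_measurable_fun cf.
have bounded_cs (k : R -> R) : continuous k -> (forall x, N <= `|x| -> k x = 0) ->
    exists C, forall x, `|k x| <= C.
  move=> ck k0; have [C C0 kC] := continuous_segment_bounded (- N) N ck.
  exists C => x; have [/k0 ->|xN] := leP N `|x|; first by rewrite normr0.
  by apply: kC; rewrite -ler_norml ltW.
apply: (@integral_derivative_vanishing _ (fun x => f x * h x) _ N s) => //.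
- by move=> x; apply: cvgM; [exact: cf|exact: ch].
- by apply: measurable_funD; exact: measurable_funM.
- by move=> x /h0 ->; rewrite mulr0.
- by move=> x Nx; rewrite h0// h'0// !mulr0 addr0.
- apply: locally_integrable1D.
    apply: locally_integrable1_continuous => x.
    by apply: cvgM; [exact: cf|exact: ch'].
  have [C hC] := bounded_cs _ ch h0.
  exact: locally_integrable1_bounded_mul hC.
- move=> x xN xs.
  have [dx cx] : continuous_derivative_at f g x.
    by apply: df => Sx; move/negP: xs; apply; exact: sP.
  split.
    apply: is_deriveR_eq (is_deriveR_M dx (is_derive1 (dh x))) _.
    by rewrite addrC.
  apply: cvgD; apply: cvgM => //.
  + exact: cf.
  + exact: ch'.
  + exact: ch.
Qed.

Lemma travelling_wave_slice f x0 s t x :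
  travelling_wave f x0 s (t, x) = f (x - (x0 + s * t)).
Proof. by rewrite /travelling_wave/= opprD addrA. Qed.

(** By Fubini, this is integration by parts on each time slice. *)
Lemma travelling_wave_weak_partial_x S f g x0 s : singular_derivative S f g ->
  weak_partial_x (travelling_wave f x0 s) (travelling_wave g x0 s).
Proof.
move=> dfg; have [cf gi lfS df] := dfg.
have li_f : locally_integrable2 (travelling_wave f x0 s).
  exact/travelling_wave_locally_integrable/locally_integrable1_continuous.
have li_g : locally_integrable2 (travelling_wave g x0 s).
  exact: travelling_wave_locally_integrable.
split=> // Phi /test_function_C1[N N0 [[cP dPt dPx cPt cPx] P0 Pt0 Px0]].
have i1 := integrable_mul_vanishing li_f cPx Px0.
have i2 := integrable_mul_vanishing li_g cP P0.
suff : (\int[mu2]_p (travelling_wave f x0 s p * partial_x Phi p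
                      + travelling_wave g x0 s p * Phi p)%:E = 0)%E.
  under eq_integral do rewrite EFinD.
  rewrite integralD//.
  rewrite -(fineK (integrable_fin_num _ i1))// -(fineK (integrable_fin_num _ i2))//.
  by rewrite -EFinD -EFinN => -[] /eqP; rewrite addr_eq0 => /eqP ->.
apply: integral_slices_eq0.
  by have := integrableD measurableT i1 i2; congr (mu2.-integrable _ _).
move=> t.
have := @singular_integration_by_parts _ _ _ (fun x => Phi (t, x)) N (ltW N0)
  (singular_derivative_shift (x0 + s * t) dfg).
under [X in (_ -> _ -> _ -> _ -> X = _) -> _]eq_integral do rewrite -!travelling_wave_slice.
apply.
- exact: dPx.
- exact: (@continuous_slice_x _ (partial_x Phi)).
- by move=> x; exact: vanishes_slice_x.
- by move=> x; exact: (vanishes_slice_x (F := partial_x Phi)).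
Qed.

(** In the moving frame, d/dt + s d/dx is the time derivative at a fixed position.
    Integrated in time first, it gives zero at each fixed position, whatever the
    value of the profile there. *)
Lemma travelling_wave_transport g x0 s Phi : locally_integrable1 g ->
  test_function Phi ->
  (\int[mu2]_p (travelling_wave g x0 s p *
                (partial_t Phi p + s * partial_x Phi p))%:E = 0)%E.
Proof.
move=> gi /test_function_C1[N N0 [CkP P0 Pt0 Px0]].
have [cP dPt dPx cPt cPx] := CkP.
pose chi p := partial_t Phi p + s * partial_x Phi p.
have cchi : continuous chi.
  move=> p; apply: cvgD; first exact: cPt.
  by apply: cvgMr; exact: cPx.
have chi0 : vanishes_off_square N chi.
  by move=> p pN; rewrite /chi Pt0// Px0// mulr0 addr0.
pose psi (p : R * R) := chi (p.1, p.2 + (x0 + s * p.1)).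
have cpsi : continuous psi.
  move=> p; rewrite /psi.
  apply/cvgrPdist_lt => e e0.
  have /cvgrPdist_lt/(_ e e0)/nbhs_ballP[d /= d0 dF] :=
    cchi (p.1, p.2 + (x0 + s * p.1)).
  have c2 : {for p, continuous (fun q : R * R => q.2 + (x0 + s * q.1))}.
    apply: cvgD; first exact: cvg_snd.
    by apply: cvgD; [exact: cvg_cst|apply: cvgMr; exact: cvg_fst].
  have c1 : {for p, continuous (fun q : R * R => q.1)} by exact: cvg_fst.
  near=> q; apply: (dF (q.1, _)); split => /=.
    by near: q; apply: c1; exact: nbhsx_ballx.
  by near: q; apply: c2; exact: nbhsx_ballx.
have psi0 : vanishes_off_square (N + `|x0| + `|s| * N) psi.
  move=> p H; apply: chi0 => /=.
  have [|tN] := leP N `|p.1|; first by left.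
  right; case: H => H.
    have : 0 <= `|x0| by [].
    have : 0 <= `|s| * N by rewrite mulr_ge0// ltW.
    lra.
  have : `|s * p.1| <= `|s| * N by rewrite normrM ler_wpM2l// ltW.
  have := ler_normD x0 (s * p.1).
  have := ler_normB (p.2 + (x0 + s * p.1)) (x0 + s * p.1).
  rewrite addrK; lra.
have li0 := travelling_wave_locally_integrable x0 s gi.
have li1 := travelling_wave_locally_integrable 0 0 gi.
rewrite -(integral12_prod_meas1 (integrable_mul_vanishing li0 cchi chi0)) /fubini_F.
have mg := locally_integrable1_measurable gi.
transitivity (\int[mu]_t \int[mu]_x
    (travelling_wave g 0 0 (t, x) * psi (t, x))%:E)%E.
  apply: eq_integral => t _.
  rewrite -[LHS](@integral_translate _ (x0 + s * t)); last first.
    apply/measurable_EFinP; apply: (measurable_fun_pair2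
      (f := fun p => travelling_wave g x0 s p * chi p)).
    apply: measurable_funM; first exact: travelling_wave_measurable.
    exact: continuous_measurable_plane.
  apply: eq_integral => x _; rewrite !travelling_wave_slice /psi/=.
  by rewrite addrK mul0r addr0 subr0.
have ii := integrable_mul_vanishing li1 cpsi psi0.
rewrite (integral12_prod_meas1 ii) -(integral21_prod_meas1 ii).
apply: integral0_eq => x _; rewrite /fubini_G.
under eq_integral do rewrite travelling_wave_slice mul0r addr0 subr0.
have cl : continuous (fun t => psi (t, x)) by exact: continuous_slice_t.
set M := N + `|x0| + `|s| * N in psi0.
have M0 : 0 <= M by rewrite /M !addr_ge0 ?mulr_ge0// ltW.
pose G t := g x * Phi (t, x + x0 + s * t).
apply: (@integral_derivative_vanishing _ G _ M [::]) => //.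
- move=> t; apply: cvgMr.
  exact: is_deriveR_continuous (is_derive_along_line s (x + x0) t CkP).
- by apply: measurable_funM => //; exact: continuous_measurable_fun.
- move=> t Mt; rewrite /G P0 ?mulr0//; left => /=.
  have : 0 <= `|x0| by [].
  have : 0 <= `|s| * N by rewrite mulr_ge0// ltW.
  rewrite /M in Mt; lra.
- by move=> t Mt; rewrite psi0 ?mulr0//; left.
- apply: locally_integrable1_continuous => t; apply: cvgMr; exact: cl.
move=> t _ _; split.
  apply: is_deriveR_Z; rewrite /psi/chi/= addrA.
  exact: is_derive_along_line.
by apply: cvgMr; exact: cl.
Unshelve. all: by end_near. Qed.

End TravellingWaves.

(** * Profiles with an explicit pressure *)

Section WaveProfiles.
Context {R : realType}.
Local Notation mu := (@lebesgue_measure R).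
Local Notation plane := (measurableTypeR R * measurableTypeR R)%type.
Local Notation mu2 := (@lebesgue_measure R \x @lebesgue_measure R)%E.
Implicit Types (s B x y xi : R) (S : set R) (f g : R -> R) (Phi : R * R -> R).

(** A first integral of - s f' + f f' + P' = 0, the equation of travelling waves. *)
Definition profile_pressure s B f x := s * f x - f x ^+ 2 / 2 - B / 2.

(** With g = f', the derivative of [profile_pressure]. *)
Definition pressure_gradient s f g x := (s - f x) * g x.

Definition pressure_source f g x := f x ^+ 2 + 2^-1 * g x ^+ 2.

(** The properties of a profile on which the weak formulation rests. The last three
    fields say that q' is bounded and continuous through the singular set S, where g
    may be unbounded, and that q - q'' is the source of the pressure off S. *)
Record wave_profile s B S f g : Prop := WaveProfile {
  wp_continuous : continuous f;
  wp_bounded : exists K, forall x, `|f x| <= K;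
  wp_measurable : measurable_fun [set: R] g;
  wp_locally_finite : locally_finite S;
  wp_derivative : forall x, ~ S x -> continuous_derivative_at f g x;
  wp_gradient_continuous : continuous (pressure_gradient s f g);
  wp_gradient_bounded : exists K, forall x, `|pressure_gradient s f g x| <= K;
  wp_gradient_derivative : forall x, ~ S x ->
    is_derive x 1 (pressure_gradient s f g)
      (profile_pressure s B f x - pressure_source f g x) }.

Lemma continuous_at_sqr f x :
  {for x, continuous f} -> {for x, continuous (fun y => f y ^+ 2)}.
Proof.
move=> cf; rewrite (_ : (fun y => _) = (fun y => f y * f y)).
  by apply: cvgM; exact: cf.
by apply/funext => y; rewrite expr2.
Qed.

Lemma profile_pressure_continuous s B f :
  continuous f -> continuous (profile_pressure s B f).
Proof.
move=> cf x; rewrite /profile_pressure.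
apply: cvgB; last exact: cvg_cst.
apply: cvgB; first by apply: cvgMr; exact: cf.
by apply: cvgMl; apply: continuous_at_sqr; exact: cf.
Qed.

Lemma profile_pressure_bounded s B f K : (forall x, `|f x| <= K) ->
  forall x, `|profile_pressure s B f x| <= `|s| * K + K ^+ 2 / 2 + `|B| / 2.
Proof.
move=> fK x; rewrite /profile_pressure.
rewrite (le_trans (ler_normB _ _))// lerD//; last first.
  by rewrite normrM [`|_^-1|]gtr0_norm.
rewrite (le_trans (ler_normB _ _))// lerD//.
  by rewrite normrM ler_wpM2l.
rewrite normrM [`|_^-1|]gtr0_norm// ler_wpM2r// normrX.
by rewrite lerXn2r// nnegrE// (le_trans _ (fK x)).
Qed.

Lemma profile_pressure_derive s B f x d : is_derive x 1 f d ->
  is_derive x 1 (profile_pressure s B f) ((s - f x) * d).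
Proof.
move=> df.
have d2 := is_deriveR_M df df.
have d3 := is_deriveR_Z (2^-1) d2.
have d4 := is_deriveR_Z s df.
have d5 := is_deriveR_B (is_deriveR_B d4 d3) (is_deriveR_cst (B / 2) x).
have -> : profile_pressure s B f = (fun y => s * f y - 2^-1 * (f y * f y) - B / 2).
  by apply/funext => y; rewrite /profile_pressure expr2 [2^-1 * _]mulrC.
by apply: is_deriveR_eq d5 _; field.
Qed.

Lemma pressure_source_continuous_at f g x : {for x, continuous f} ->
  {for x, continuous g} -> {for x, continuous (pressure_source f g)}.
Proof.
move=> cf cg; apply: cvgD; first by apply: continuous_at_sqr; exact: cf.
by apply: cvgMr; apply: continuous_at_sqr; exact: cg.
Qed.

Lemma pressure_source_ge0 f g x : 0 <= pressure_source f g x.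
Proof.
rewrite /pressure_source; have := sqr_ge0 (f x); have := sqr_ge0 (g x); lra.
Qed.

Lemma pressure_source_measurable f g : continuous f ->
  measurable_fun [set: R] g -> measurable_fun [set: R] (pressure_source f g).
Proof.
move=> cf mg; have mf := continuous_measurable_fun cf.
by apply: measurable_funD; [exact: measurable_funX|
  apply: measurable_funM => //; exact: measurable_funX].
Qed.

Section Fixed.
Variables (s B : R) (S : set R) (f g : R -> R).
Hypothesis fg : wave_profile s B S f g.
Local Notation q := (profile_pressure s B f).
Local Notation r := (pressure_gradient s f g).
Local Notation e := (pressure_source f g).

(** The derivative of the continuous function q' is q - f ^ 2 minus g ^ 2 / 2, where
    q - f ^ 2 is bounded.  So C - q'' is nonnegative for a large constant C, its
    integrals are finite because q' has finite increments, and it dominates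
    g ^ 2 / 2. *)
Lemma locally_integrable1_sqr : locally_integrable1 (fun x => g x ^+ 2).
Proof.
have [cf [K fK] mg lfS dS cr _ dr] := fg.
pose C := `|s| * K + K ^+ 2 / 2 + `|B| / 2.
have qC x : `|q x| <= C by exact: profile_pressure_bounded.
pose h x := e x - q x + C.
have ge x : 2^-1 * g x ^+ 2 <= h x.
  rewrite /h /pressure_source; have := qC x; rewrite ler_norml => /andP[_].
  have := sqr_ge0 (f x); lra.
have h0 x : 0 <= h x by apply: le_trans (ge x); rewrite mulr_ge0// sqr_ge0.
have mh : measurable_fun [set: R] h.
  apply: measurable_funD => //; apply: measurable_funB.
    exact: pressure_source_measurable.
  by apply: continuous_measurable_fun; exact: profile_pressure_continuous.
have hi : locally_integrable1 h.
  move=> a b; apply/integrableP; split.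
    by apply: measurable_funTS; exact/measurable_EFinP.
  have [ab|ba] := leP a b; last by rewrite set_itv_ge ?integral_set0// bnd_simp -ltNge.
  have [l lP] := lfS a b.
  under eq_integral do rewrite /= ger0_norm//.
  rewrite (@singular_ftc _ (fun x => - r x + C * x) h l) ?ltry//.
  - move=> x; apply: cvgD; first by apply: cvgN; exact: cr.
    by apply: cvgMr; exact: cvg_id.
  - by left.
  - move=> x xab xl.
    have nSx : ~ S x by move=> Sx; move/negP: xl; apply; exact: lP.
    have [dx cx] := dS _ nSx; split.
      have d1 := is_deriveR_D (is_deriveR_N (dr _ nSx)) (is_deriveR_Z C (is_deriveR_id x)).
      by apply: is_deriveR_eq d1 _; rewrite /h; ring.
    apply: cvgD; last exact: cvg_cst.
    apply: cvgB; last exact: profile_pressure_continuous.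
    by apply: pressure_source_continuous_at => //; exact: cf.
have h2i : locally_integrable1 (fun x => h x * (cst 2 : R -> R) x).
  by apply: (@locally_integrable1_bounded_mul _ _ _ 2) => // x; rewrite /= ger0_norm.
apply: locally_integrable1_le h2i; first exact: measurable_funX.
by move=> x; rewrite ger0_norm ?sqr_ge0//=; have := ge x; lra.
Qed.

(** Because |g| <= 1 + g ^ 2. *)
Lemma locally_integrable1_profile_derivative : locally_integrable1 g.
Proof.
have := locally_integrable1D (locally_integrable1_continuous (@cst_continuous R R 1))
  locally_integrable1_sqr.
apply: locally_integrable1_le; first exact: wp_measurable fg.
move=> x /=; have := sqr_ge0 (`|g x| - 2^-1); rewrite sqrrB real_normK ?num_real//.
have : 0 <= `|g x| by []. lra.
Qed.

Lemma profile_singular_derivative : singular_derivative S f g.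
Proof.
have [cf _ _ lfS dS _ _ _] := fg.
by split => //; exact: locally_integrable1_profile_derivative.
Qed.

Let kernel xi y := 2^-1 * expR (- `|xi - y|) * e y.

Let kernel_measurable xi : measurable_fun [set: R] (kernel xi).
Proof.
apply: measurable_funM; last first.
  by apply: pressure_source_measurable; [exact: wp_continuous fg|exact: wp_measurable fg].
apply: continuous_measurable_fun => y; apply: cvgMr.
apply: continuous_comp; last exact: continuous_expR.
apply: cvgN; apply: cvg_norm; apply: cvgB; [exact: cvg_cst|exact: cvg_id].
Qed.

Let kernel_ge0 xi y : 0 <= kernel xi y.
Proof. by rewrite mulr_ge0 ?pressure_source_ge0 ?mulr_ge0 ?expR_ge0. Qed.

Let exp_weighted_source (c xi y d : R) : ~ S y -> 
  is_derive y 1 (fun y => c * (expR (d * (y - xi)) * (q y - d * r y)))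
    (c * (d * expR (d * (y - xi)) * (q y - d * r y) +
      expR (d * (y - xi)) * (r y - d * (q y - e y)))).
Proof.
move=> nSy; have [dy _] := wp_derivative fg nSy.
have de : is_derive y 1 (fun y => expR (d * (y - xi))) (d * expR (d * (y - xi))).
  have d1 := is_deriveR_Z d (is_deriveR_B (is_deriveR_id y) (is_deriveR_cst xi y)).
  have := @is_deriveR_comp _ expR (fun y => d * (y - xi)) y _ _ (is_derive_expR _) d1.
  by rewrite subr0 mulr1 [expR _ * d]mulrC.
have dq := profile_pressure_derive s B dy.
have dr := wp_gradient_derivative fg nSy.
exact: is_deriveR_Z (is_deriveR_M de (is_deriveR_B dq (is_deriveR_Z d dr))).
Qed.

(** The function d / 2 exp(d (y - xi)) (q - d q')(y) is an antiderivative of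
    exp(d (y - xi)) (q - q'') / 2; the sign d is 1 to the left of xi and - 1 to the
    right. *)
Let integral_half_kernel (d xi a b : R) : d ^+ 2 = 1 -> a <= b ->
  (forall y, a <= y <= b -> `|xi - y| = - (d * (y - xi))) ->
  (\int[mu]_(y in `[a, b]) (kernel xi y)%:E =
   (d / 2 * (expR (d * (b - xi)) * (q b - d * r b)) -
    d / 2 * (expR (d * (a - xi)) * (q a - d * r a)))%:E)%E.
Proof.
move=> d1 ab xiE.
have [cf _ mg lfS dS cr _ dr] := fg.
have [l lP] := lfS a b.
have cexp : continuous (fun y : R => expR (d * (y - xi))).
  move=> y; apply: continuous_comp; last exact: continuous_expR.
  by apply: cvgMr; apply: cvgB; [exact: cvg_id|exact: cvg_cst].
pose k y := 2^-1 * expR (d * (y - xi)) * e y.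
transitivity (\int[mu]_(y in `[a, b]) (k y)%:E)%E.
  apply: eq_integral => y; rewrite inE/= in_itv/= => yab.
  by rewrite /k /kernel xiE// opprK.
apply: (@singular_ftc _ (fun y => d / 2 * (expR (d * (y - xi)) * (q y - d * r y))) k l a b).
- exact: ab.
- move=> y; apply: cvgMr; apply: cvgM; first exact: cexp.
  apply: cvgB; first exact: profile_pressure_continuous.
  by apply: cvgMr; exact: cr.
- apply: measurable_funM; last exact: pressure_source_measurable.
  by apply: continuous_measurable_fun => y; apply: cvgMr; exact: cexp.
- by left => y; rewrite /k mulr_ge0 ?pressure_source_ge0 ?mulr_ge0 ?expR_ge0.
- move=> y yab yl.
  have nSy : ~ S y by move=> Sy; move/negP: yl; apply; exact: lP.
  have [dy cy] := dS _ nSy; split.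
    apply: is_deriveR_eq (exp_weighted_source _ _ _ nSy) _.
    by rewrite /k; move/eqP: d1; rewrite sqrf_eq1 => /orP[]/eqP ->; field.
  apply: cvgM; first by apply: cvgMr; exact: cexp.
  by apply: pressure_source_continuous_at => //; exact: cf.
Qed.

Let integral_kernel_symmetric xi (n : R) : 0 <= n ->
  (\int[mu]_(y in `[(xi - n)%R, (xi + n)%R]) (kernel xi y)%:E =
   (q xi - expR (- n) * (2^-1 * ((q (xi - n) - r (xi - n)) +
                                 (q (xi + n) + r (xi + n)))))%:E)%E.
Proof.
move=> n0.
have mk A : measurable_fun A (fun y => (kernel xi y)%:E).
  by apply: measurable_funTS; exact/measurable_EFinP.
rewrite (@itv_bndbnd_setU _ _ _ (BRight xi)); [|by rewrite bnd_simp; lra..].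
rewrite integral_setU //=; [|exact: mk|]; last first.
  by apply: lt_disjoint => x y; rewrite !in_itv/= => /andP[_ ?] /andP[? _]; lra.
rewrite integral_itv_obnd_cbnd; last exact: mk.
rewrite (@integral_half_kernel 1) ?expr1n//; last 2 first.
- lra.
- by move=> y yI; rewrite ger0_norm; lra.
rewrite (@integral_half_kernel (- 1)) ?sqrrN ?expr1n//; last 2 first.
- lra.
- by move=> y yI; rewrite ler0_norm; lra.
rewrite -EFinD; congr EFin.
rewrite subrr !mulr0 expR0.
rewrite (_ : 1 * (xi - n - xi) = - n); last by ring.
rewrite (_ : -1 * (xi + n - xi) = - n); last by ring.
by field.
Qed.

(** Half the exponential of - |x| is the Green function of 1 - d^2/dx^2.  The boundary
    terms at xi - n and xi + n are bounded by a multiple of exp(- n), as q and q' are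
    bounded. *)
Lemma integral_pressure_kernel xi :
  (\int[mu]_y (2^-1 * expR (- `|xi - y|) * e y)%:E = (q xi)%:E)%E.
Proof.
have [cf [K fK] _ _ _ _ [L rL] _] := fg.
pose C := `|s| * K + K ^+ 2 / 2 + `|B| / 2.
have qC x : `|q x| <= C by exact: profile_pressure_bounded.
have mk A : measurable_fun A (fun y => (kernel xi y)%:E).
  by apply: measurable_funTS; exact/measurable_EFinP.
pose F (n : nat) : set R := `[xi - n%:R, xi + n%:R]%classic.
have FT : \bigcup_n F n = setT.
  apply/seteqP; split => // y _; exists (Num.truncn `|y - xi|).+1 => //.
  have := truncnS_gt `|y - xi|; rewrite ltr_norml => /andP[h1 h2].
  by rewrite /F/= in_itv/=; apply/andP; split; lra.
have : (\int[mu]_(y in F n) (kernel xi y)%:E)%E @[n --> \oo] -->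
    (\int[mu]_(y in \bigcup_n F n) (kernel xi y)%:E)%E.
  apply: integral_nondecreasing_set_cvg => //.
  - move=> m n mn; rewrite subsetEset => y; rewrite /F/= !in_itv/=.
    have : m%:R <= n%:R :> R by rewrite ler_nat.
    by move=> ? /andP[? ?]; apply/andP; split; lra.
  - by move=> n; exact: measurable_itv.
  - exact: mk.
  - by left => y _; rewrite lee_fin.
rewrite FT => /cvg_unique; apply; first exact: ereal_hausdorff.
have -> : (fun n => \int[mu]_(y in F n) (kernel xi y)%:E)%E = (fun n : nat =>
    (q xi - expR (- n%:R) * (2^-1 * ((q (xi - n%:R) - r (xi - n%:R)) +
                                (q (xi + n%:R) + r (xi + n%:R)))))%:E).
  by apply/funext => n; rewrite /F integral_kernel_symmetric.
apply: cvg_EFin; first by near=> n.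
apply/cvgrPdist_le => /= eps eps0.
have C0 : 0 <= C := le_trans (normr_ge0 _) (qC 0).
have L0 : 0 <= L := le_trans (normr_ge0 _) (rL 0).
have CL1 : 0 < C + L + 1 by lra.
near=> n.
rewrite opprB addrC subrK normrM ger0_norm ?expR_ge0//.
have bound : `|2^-1 * (q (xi - n%:R) - r (xi - n%:R) + (q (xi + n%:R) + r (xi + n%:R)))| <= C + L.
  rewrite normrM [`|2^-1|]gtr0_norm// ler_pdivrMl//.
  have h1 := ler_normD (q (xi - n%:R) - r (xi - n%:R)) (q (xi + n%:R) + r (xi + n%:R)).
  have h2 := ler_normB (q (xi - n%:R)) (r (xi - n%:R)).
  have h3 := ler_normD (q (xi + n%:R)) (r (xi + n%:R)).
  have := qC (xi - n%:R); have := qC (xi + n%:R).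
  have := rL (xi - n%:R); have := rL (xi + n%:R); lra.
apply: (le_trans (ler_wpM2l (expR_ge0 _) bound)).
have en : expR (- n%:R) < eps / (C + L + 1) :> R.
  near: n; apply: (cvgr_lt 0); first exact: cvgn_expR.
  by rewrite divr_gt0.
rewrite ltr_pdivlMr// in en; apply: le_trans (ltW en).
by rewrite ler_wpM2l ?expR_ge0//; lra.
Unshelve. all: by end_near. Qed.

Section Wave.
Variable x0 : R.
Local Notation u := (travelling_wave f x0 s).
Local Notation ux := (travelling_wave g x0 s).

Let P_integrandE t x y : P_integrand u ux t x (y + (x0 + s * t)) =
  kernel (x - (x0 + s * t)) y.
Proof.
rewrite /P_integrand !travelling_wave_slice addrK /kernel.
by congr (_ * expR (- `|_|) * _); ring.
Qed.

Let P_integrand_measurable t x :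
  measurable_fun [set: R] (P_integrand u ux t x).
Proof.
rewrite (_ : P_integrand u ux t x =
    (kernel (x - (x0 + s * t))) \o (fun y => y - (x0 + s * t))).
  by apply: measurableT_comp => //; exact: measurable_funB.
by apply/funext => y /=; rewrite -P_integrandE subrK.
Qed.

Let integral_P_integrand t x :
  (\int[mu]_y (P_integrand u ux t x y)%:E = (q (x - (x0 + s * t)))%:E)%E.
Proof.
rewrite -integral_pressure_kernel.
rewrite -[LHS](@integral_translate _ (x0 + s * t)); last exact/measurable_EFinP.
by apply: eq_integral => y _; rewrite P_integrandE.
Qed.

Lemma P_integrand_integrable t x :
  mu.-integrable [set: R] (EFin \o P_integrand u ux t x).
Proof.
apply/integrableP; split.
  by apply/measurable_EFinP; exact: P_integrand_measurable.
have P0 y : 0 <= P_integrand u ux t x y.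
  rewrite -(subrK (x0 + s * t) y) P_integrandE; exact: kernel_ge0.
under eq_integral do rewrite /= ger0_norm ?P0//.
by rewrite integral_P_integrand ltry.
Qed.

Lemma P_travelling_wave p : P u ux p = q (p.2 - x0 - s * p.1).
Proof.
rewrite /P /Rintegral integral_P_integrand /= opprD addrA.
by case: p.
Qed.

Lemma density_travelling_wave :
  density u ux = travelling_wave (fun y => f y ^+ 2 + g y ^+ 2) x0 s.
Proof. by []. Qed.

Lemma flux_travelling_wave :
  flux u ux = travelling_wave (fun y => f y * g y ^+ 2 + 2 * q y * f y) x0 s.
Proof.
apply/funext => p; rewrite /flux P_travelling_wave /travelling_wave.
by ring.
Qed.

End Wave.
End Fixed.
End WaveProfiles.

(** * The flux defect *)

Section WaveEquation.
Context {R : realType}.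
Local Notation mu := (@lebesgue_measure R).
Local Notation plane := (measurableTypeR R * measurableTypeR R)%type.
Local Notation mu2 := (@lebesgue_measure R \x @lebesgue_measure R)%E.
Variables (s B : R) (S : set R) (f g : R -> R) (x0 : R).
Hypothesis fg : wave_profile s B S f g.
Local Notation q := (profile_pressure s B f).
Local Notation u := (travelling_wave f x0 s).
Local Notation ux := (travelling_wave g x0 s).

Let cf : continuous f := wp_continuous fg.
Let cq : continuous q. Proof. exact: profile_pressure_continuous cf. Qed.

Lemma density_profile_locally_integrable :
  locally_integrable1 (fun y => f y ^+ 2 + g y ^+ 2).
Proof.
apply: locally_integrable1D; last exact: locally_integrable1_sqr fg.
by apply: locally_integrable1_continuous => y; apply: continuous_at_sqr; exact: cf.
Qed.

Lemma flux_profile_locally_integrable :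
  locally_integrable1 (fun y => f y * g y ^+ 2 + 2 * q y * f y).
Proof.
apply: locally_integrable1D; last first.
  apply: locally_integrable1_continuous => y; apply: cvgM; last exact: cf.
  by apply: cvgMr; exact: cq.
have [K fK] := wp_bounded fg.
have := locally_integrable1_bounded_mul (locally_integrable1_sqr fg)
  (continuous_measurable_fun cf) fK.
by under eq_fun do rewrite mulrC.
Qed.

Lemma wave_profile_has_weak_formulation : has_weak_formulation u ux.
Proof.
split.
- exact: travelling_wave_weak_partial_x (profile_singular_derivative fg).
- by apply: aeW => t x; exact: P_integrand_integrable fg x0 t x.
- rewrite density_travelling_wave.
  exact: travelling_wave_locally_integrable density_profile_locally_integrable.
- rewrite (flux_travelling_wave fg).
  exact: travelling_wave_locally_integrable flux_profile_locally_integrable.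
Qed.

(** The flux through a point that moves with the wave. *)
Definition flux_defect y :=
  f y * g y ^+ 2 + 2 * q y * f y - s * (f y ^+ 2 + g y ^+ 2).

Lemma flux_defect_locally_integrable : locally_integrable1 flux_defect.
Proof.
apply: locally_integrable1D; first exact: flux_profile_locally_integrable.
have mD := locally_integrable1_measurable density_profile_locally_integrable.
have := locally_integrable1_bounded_mul (h := cst (- s)) (C := `|s|)
  density_profile_locally_integrable (measurable_cst _).
rewrite /= normrN => /(_ (fun=> lexx _)); congr locally_integrable1.
by apply/funext => y; rewrite mulrN mulrC.
Qed.

Lemma flux_defect_continuous_at y : ~ S y -> {for y, continuous flux_defect}.
Proof.
move=> /(wp_derivative fg)[_ cg].
apply: cvgB; first apply: cvgD.
- by apply: cvgM; [exact: cf|exact: continuous_at_sqr].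
- by apply: cvgM; [apply: cvgMr; exact: cq|exact: cf].
- apply: cvgMr; apply: cvgD; apply: continuous_at_sqr => //; exact: cf.
Qed.

(** The density is transported with the wave, so that its contribution with speed s
    cancels and only the excess of the flux over s times the density remains. *)
Lemma weak_equation_flux_defect Phi : test_function Phi ->
  (\int[mu2]_p (density u ux p * partial_t Phi p +
                flux u ux p * partial_x Phi p)%:E =
   \int[mu2]_p (travelling_wave flux_defect x0 s p * partial_x Phi p)%:E)%E.
Proof.
move=> tP; have [N N0 [[cP dPt dPx cPt cPx] P0 Pt0 Px0]] := test_function_C1 tP.
rewrite density_travelling_wave (flux_travelling_wave fg).
set D := fun y => f y ^+ 2 + g y ^+ 2.
transitivity (\int[mu2]_p
  ((travelling_wave D x0 s p * (partial_t Phi p + s * partial_x Phi p))%:E +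
   (travelling_wave flux_defect x0 s p * partial_x Phi p)%:E))%E.
  apply: eq_integral => p _; rewrite -EFinD; congr EFin.
  by rewrite /travelling_wave /flux_defect /D; ring.
have Di := density_profile_locally_integrable.
rewrite integralD//; first by rewrite travelling_wave_transport// add0e.
- apply: (@integrable_mul_vanishing _ _ (fun p => partial_t Phi p + s * partial_x Phi p) N).
  + exact: travelling_wave_locally_integrable.
  + by move=> p; apply: cvgD; [exact: cPt|apply: cvgMr; exact: cPx].
  + by move=> p pN; rewrite Pt0// Px0// mulr0 addr0.
- apply: integrable_mul_vanishing Px0 => //.
  exact/travelling_wave_locally_integrable/flux_defect_locally_integrable.
Qed.

Lemma integral_flux_defect_slices Phi : test_function Phi ->
  (\int[mu2]_p (travelling_wave flux_defect x0 s p * partial_x Phi p)%:E =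
   \int[mu]_t \int[mu]_x
      (flux_defect (x - (x0 + s * t)) * partial_x Phi (t, x))%:E)%E.
Proof.
move=> tP; have [N N0 [[cP dPt dPx cPt cPx] P0 Pt0 Px0]] := test_function_C1 tP.
have Ei := travelling_wave_locally_integrable x0 s flux_defect_locally_integrable.
rewrite -(integral12_prod_meas1 (integrable_mul_vanishing Ei cPx Px0)).
apply: eq_integral => t _; apply: eq_integral => x _.
by rewrite travelling_wave_slice.
Qed.

(** Against a function that is constant on both sides of c, the integral of h' leaves
    one boundary term at c.  With c1 = c2 this is the case of a constant defect. *)
Lemma integral_defect_jump (h : R -> R) (k a c b c1 c2 : R) :
  a <= c <= b ->
  (forall y, a < y < c -> ~ S y -> flux_defect y = c1) ->
  (forall y, c < y < b -> ~ S y -> flux_defect y = c2) ->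
  (forall x, derivable h x 1) -> continuous (derive1 h) ->
  (forall y, ~ (a < y < b) -> h (y + k) = 0) ->
  (forall y, ~ (a < y < b) -> derive1 h (y + k) = 0) ->
  (\int[mu]_x (flux_defect (x - k) * derive1 h x)%:E =
   ((c1 - c2) * h (c + k))%:E)%E.
Proof.
move=> /andP[ac cb] E1 E2 dh ch' h0 h'0.
have ch : continuous h by move=> x; exact: is_deriveR_continuous (is_derive1 (dh x)).
have Ei := flux_defect_locally_integrable.
have mE := locally_integrable1_measurable Ei.
have cshift : continuous (fun y : R => y + k).
  by move=> y; apply: cvgD; [exact: cvg_id|exact: cvg_cst].
have chk : continuous (fun y => h (y + k)).
  by move=> y; apply: continuous_comp; [exact: cshift|exact: ch].
have ch'k : continuous (fun y => derive1 h (y + k)).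
  by move=> y; apply: continuous_comp; [exact: cshift|exact: ch'].
have mh'k := continuous_measurable_fun ch'k.
pose w y := flux_defect y * derive1 h (y + k).
have mw : measurable_fun [set: R] w by exact: measurable_funM.
have mwE A : measurable_fun A (fun y => (w y)%:E).
  by apply: measurable_funTS; exact/measurable_EFinP.
transitivity (\int[mu]_y (w y)%:E)%E.
  rewrite -[RHS](@integral_translate _ (- k)); last exact: mwE.
  by apply: eq_integral => x _; rewrite /w subrK.
transitivity (\int[mu]_(y in `[a, b]) (w y)%:E)%E.
  rewrite [RHS]integral_mkcond; apply: eq_integral => y _.
  rewrite patchE; case: ifPn => // /negP; rewrite inE/= in_itv/= => yab.
  by rewrite /w h'0 ?mulr0// => /andP[? ?]; apply: yab; apply/andP; split; exact: ltW.
have wi : mu.-integrable `[a, b] (EFin \o w).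
  have [C hC] : exists C, forall y, `|derive1 h (y + k)| <= C.
    have [C C0 hC] := continuous_segment_bounded a b ch'k.
    exists C => y; have [/andP[ay yb]|yab] := pselect (a < y < b).
      by apply: hC; rewrite !ltW.
    by rewrite h'0// normr0.
  exact: (locally_integrable1_bounded_mul Ei mh'k hC).
have [l lP] := wp_locally_finite fg a b.
have ftc_piece a' b' c0 : a <= a' -> a' <= b' -> b' <= b ->
    (forall y, a' < y < b' -> ~ S y -> flux_defect y = c0) ->
    (\int[mu]_(y in `[a', b']) (w y)%:E =
      (c0 * h (b' + k) - c0 * h (a' + k))%:E)%E.
  move=> aa ab bb Ec.
  apply: (@singular_ftc _ (fun y => c0 * h (y + k)) w l a' b').
  - exact: ab.
  - by move=> y; apply: cvgMr; exact: chk.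
  - exact: mw.
  - right; apply: integrableS wi => //.
    by apply: subset_itv; rewrite bnd_simp.
  - move=> y yab yl.
    have nSy : ~ S y.
      move=> Sy; move/negP: yl; apply; apply: lP Sy.
      by case/andP: yab => ? ?; apply/andP; split; lra.
    split.
      rewrite /w (Ec y)//; apply: is_deriveR_Z.
      have := @is_deriveR_shift _ h y (- k) (derive1 h (y + k)).
      rewrite opprK; apply; exact: is_derive1.
    by apply: cvgM; [exact: flux_defect_continuous_at|exact: ch'k].
rewrite (@itv_bndbnd_setU _ _ _ (BRight c)); [|by rewrite bnd_simp; lra..].
rewrite integral_setU //=; [|exact: mwE|]; last first.
  by apply: lt_disjoint => x y; rewrite !in_itv/= => /andP[_ ?] /andP[? _]; lra.
rewrite integral_itv_obnd_cbnd; last exact: mwE.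
rewrite (ftc_piece _ _ c1)// (ftc_piece _ _ c2)// -EFinD; congr EFin.
rewrite (h0 a) ?ltxx// (h0 b) ?ltxx ?andbF//; ring.
Qed.

Lemma wave_profile_satisfies_weakly c :
  (forall y, ~ S y -> flux_defect y = c) -> satisfies_weakly u.
Proof.
move=> Ec; exists ux; first exact: wave_profile_has_weak_formulation.
move=> Phi tP; rewrite weak_equation_flux_defect// integral_flux_defect_slices//.
have [N N0 [[cP dPt dPx cPt cPx] P0 Pt0 Px0]] := test_function_C1 tP.
apply: integral0_eq => t _.
pose M := N + `|x0 + s * t|.
have outside y : ~ (- M < y < M) -> N <= `|y + (x0 + s * t)|.
  move=> /negP; rewrite -ltr_norml -leNgt /M => My.
  have := ler_normB (y + (x0 + s * t)) (x0 + s * t); rewrite addrK; lra.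
have M0 : 0 <= M by rewrite addr_ge0// ltW.
(* the two values being equal, any point can play the part of the jump *)
rewrite (@integral_defect_jump (fun x => Phi (t, x)) _ (- M) 0 M c c) //.
- by rewrite subrr mul0r.
- by apply/andP; split; lra.
- by move=> y _; exact: Ec.
- by move=> y _; exact: Ec.
- exact: (@continuous_slice_x _ (partial_x Phi)).
- by move=> y /outside ?; apply: P0; right.
- by move=> y /outside Ny; exact: (Px0 (t, y + (x0 + s * t)) (or_intror Ny)).
Qed.

End WaveEquation.

(** * Smooth bump functions *)

Section Smooth.
Context {R : realType}.
Implicit Types (f g : R -> R) (a b c x : R) (p : {poly R}).

Fixpoint C1n (n : nat) f : Prop :=
  if n is n'.+1 then (forall x, derivable f x 1) /\ C1n n' (derive1 f)
  else continuous f.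

Definition smooth f := forall n, C1n n f.

Lemma C1nS n f : C1n n.+1 f -> C1n n f.
Proof.
elim: n f => [f [df _] x|n IH f [df cf]].
  exact: is_deriveR_continuous (is_derive1 (df x)).
by split => //; exact: IH.
Qed.

Lemma C1nD n f g : C1n n f -> C1n n g -> C1n n (fun x => f x + g x).
Proof.
elim: n f g => [f g cf cg x|n IH f g [df cf] [dg cg]].
  by apply: cvgD; [exact: cf|exact: cg].
have dfg x := is_deriveR_D (is_derive1 (df x)) (is_derive1 (dg x)).
split => [x|]; first by case: (dfg x).
rewrite (_ : derive1 _ = (fun x => derive1 f x + derive1 g x)); first exact: IH.
by apply/funext => x; exact: is_derive_derive1.
Qed.

Lemma C1nM n f g : C1n n f -> C1n n g -> C1n n (fun x => f x * g x).
Proof.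
elim: n f g => [f g cf cg x|n IH f g].
  by apply: cvgM; [exact: cf|exact: cg].
move=> cf' cg'; have [df cf] := cf'; have [dg cg] := cg'.
have dfg x := is_deriveR_M (is_derive1 (df x)) (is_derive1 (dg x)).
split => [x|]; first by case: (dfg x).
rewrite (_ : derive1 _ = (fun x => derive1 f x * g x + f x * derive1 g x)).
  by apply: C1nD; apply: IH => //; exact: C1nS.
by apply/funext => x; exact: is_derive_derive1.
Qed.

Lemma C1nZ n f k : C1n n f -> C1n n (fun x => k * f x).
Proof.
elim: n f => [f cf x|n IH f [df cf]].
  by apply: cvgMr; exact: cf.
have dkf x := is_deriveR_Z k (is_derive1 (df x)).
split => [x|]; first by case: (dkf x).
rewrite (_ : derive1 _ = (fun x => k * derive1 f x)); first exact: IH.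
by apply/funext => x; exact: is_derive_derive1.
Qed.

Lemma C1n_affine n f c k : C1n n f -> C1n n (fun x => f (c + k * x)).
Proof.
have cc : continuous (fun x : R => c + k * x).
  by move=> x; exact: is_deriveR_continuous (is_deriveR_affine c k x).
elim: n f => [f cf x|n IH f [df cf]].
  by apply: continuous_comp; [exact: cc|exact: cf].
have dkf x := @is_deriveR_comp _ f (fun x => c + k * x) x _ _
  (is_derive1 (df (c + k * x))) (is_deriveR_affine c k x).
split => [x|]; first by case: (dkf x).
rewrite (_ : derive1 _ = (fun x => k * derive1 f (c + k * x))).
  by apply: C1nZ; exact: IH.
by apply/funext => x; rewrite [RHS]mulrC; exact: is_derive_derive1.
Qed.

(** The functions p(1/x) exp(- c/x), extended by zero.  A polynomial p is allowed
    because this makes the family stable under derivation. *)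
Definition flat_exp c p x :=
  if 0 < x then p.[x^-1] * expR (- (c * x^-1)) else 0.

Lemma horner_le_expn p y : 1 <= y ->
  `|p.[y]| <= (\sum_(i < size p) `|p`_i|) * y ^+ size p.
Proof.
move=> y1; rewrite horner_coef (le_trans (ler_norm_sum _ _ _))// mulr_suml.
apply: ler_sum => i _; rewrite normrM ler_wpM2l// normrX.
rewrite ger0_norm; last by rewrite (le_trans _ y1).
by rewrite ler_weXn2l// ltnW.
Qed.

(** In terms of y = 1/x, the exponential exp(c y) outgrows y ^ (size p + 2).  The
    remaining factor x ^ 2 gives the derivative 0 at the origin. *)
Lemma flat_exp_le_sqr c p : 0 < c ->
  exists2 C, 0 <= C & forall x, `|x| <= 1 -> `|flat_exp c p x| <= C * x ^+ 2.
Proof.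
move=> c0; pose A := \sum_(i < size p) `|p`_i|.
have A0 : 0 <= A by apply: sumr_ge0.
pose n := (size p).+1.
pose C := A * n.+1`!%:R / c ^+ n.+1.
have C0 : 0 <= C.
  apply: divr_ge0; last by apply: exprn_ge0; exact: ltW.
  by apply: mulr_ge0 => //; exact: ler0n.
exists C => // x x1; rewrite /flat_exp; case: ifPn => [x0|_]; last first.
  by rewrite normr0 mulr_ge0 ?sqr_ge0.
move: x1; rewrite gtr0_norm// => x1.
set y := x^-1; have y1 : 1 <= y by rewrite invf_ge1.
have y0 : 0 < y by rewrite invr_gt0.
have cy0 : 0 <= c * y by rewrite mulr_ge0 ?ltW.
rewrite normrM (ger0_norm (expR_ge0 _)) expRN.
rewrite ler_pdivrMr ?expR_gt0//.
apply: le_trans (horner_le_expn p y1) _; rewrite -/A.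
have eb : (c * y) ^+ n.+1 / n.+1`!%:R <= expR (c * y).
  by apply: le_trans (expR_ge1Dxn n cy0); rewrite lerDr.
have Cx0 : 0 <= C * x ^+ 2 by rewrite mulr_ge0 ?sqr_ge0.
apply: le_trans (ler_wpM2l Cx0 eb).
rewrite le_eqVlt; apply/orP; left; apply/eqP.
rewrite exprMn /n !exprS -/y (_ : x = y^-1); last by rewrite /y invrK.
rewrite /C /n !exprS; field.
rewrite (gt_eqF y0) (gt_eqF c0) ?expf_neq0 ?(gt_eqF c0)//=.
by rewrite pnatr_eq0 -lt0n fact_gt0.
Qed.

Definition flat_exp_deriv c p : {poly R} := (c *: p - p^`()) * 'X^2.

Lemma is_derive_flat_exp c p x : 0 < c ->
  is_derive x 1 (flat_exp c p) (flat_exp c (flat_exp_deriv c p) x).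
Proof.
move=> c0; have [x0|x0|->] := ltgtP x 0.
- rewrite {2}/flat_exp ltNge ltW//=.
  apply: is_deriveR_near (is_deriveR_cst 0 x).
  near=> y; rewrite /flat_exp ltNge ltW//.
  by near: y; exact: lt_nbhsl.
- rewrite {2}/flat_exp x0.
  have dV : is_derive x 1 (fun y : R => y^-1) (- x ^- 2).
    have := @is_deriveV _ (fun y : R => y) x 1 1 (lt0r_neq0 x0) (is_deriveR_id x).
    by rewrite [_ *: 1]mulr1.
  have dp : is_derive x^-1 1 (fun y => p.[y]) (p^`().[x^-1]).
    exact: is_derive_poly.
  have d1 := @is_deriveR_comp _ (fun y => p.[y]) (fun y => y^-1) x _ _ dp dV.
  have d2 := is_deriveR_N (is_deriveR_Z c dV).
  have d3 := @is_deriveR_comp _ expR (fun y => - (c * y^-1)) x _ _ (is_derive_expR _) d2.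
  have d4 := is_deriveR_M d1 d3.
  apply: is_deriveR_near (is_deriveR_eq d4 _); last first.
    rewrite /flat_exp_deriv hornerM hornerXn hornerD hornerN hornerZ.
    set E := expR _; set a := p.[_]; set b := _.[x^-1]; field.
    by rewrite lt0r_neq0.
  near=> y; rewrite /flat_exp ifT//.
  by near: y; exact: lt_nbhsr.
rewrite {2}/flat_exp ltxx.
apply: cvg_is_derive.
have [C C0 Cx] := flat_exp_le_sqr p c0.
apply/cvgrPdist_le => e e0.
near=> h.
have h0 : h != 0 by near: h; exact: nbhs_dnbhs_neq.
have h1 : `|h| <= 1 by near: h; exact: dnbhs0_le.
have C1 : 0 < C + 1 by lra.
have he : `|h| <= e / (C + 1) by near: h; apply: dnbhs0_le; rewrite divr_gt0//; lra.
rewrite sub0r normrN addr0 {2}/flat_exp ltxx subr0 normrM normfV.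
rewrite mulrC ler_pdivrMr ?normr_gt0//.
apply: le_trans (Cx _ h1) _; rewrite -real_normK ?num_real// expr2 mulrA.
rewrite ler_wpM2r//.
have := he; rewrite ler_pdivlMr// => he'.
apply: le_trans he'; rewrite mulrC ler_wpM2l//; lra.
Unshelve. all: by end_near. Qed.

Lemma smooth_flat_exp c p : 0 < c -> smooth (flat_exp c p).
Proof.
move=> c0 n; elim: n p => [p x|n IH p].
  exact: is_deriveR_continuous (is_derive_flat_exp p x c0).
split => [x|]; first by case: (is_derive_flat_exp p x c0).
rewrite (_ : derive1 _ = flat_exp c (flat_exp_deriv c p)); first exact: IH.
by apply/funext => x; exact/is_derive_derive1/is_derive_flat_exp.
Qed.

(** As n grows, the exponents tend to zero and the bumps tend to the indicator function
    of ]a, b[, while they remain smooth. *)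
Definition bump_function a b (n : nat) x :=
  flat_exp (n.+1%:R^-1) 1 (- a + 1 * x) * flat_exp (n.+1%:R^-1) 1 (b + -1 * x).

Lemma smooth_bump a b n : smooth (bump_function a b n).
Proof.
by move=> k; apply: C1nM; apply: C1n_affine; apply: smooth_flat_exp;
  rewrite invr_gt0.
Qed.

Lemma flat_exp1_ge0 c x : 0 <= flat_exp c 1 x.
Proof. by rewrite /flat_exp; case: ifP => // _; rewrite hornerC mul1r expR_ge0. Qed.

Lemma flat_exp1_le1 c x : 0 < c -> flat_exp c 1 x <= 1.
Proof.
move=> c0; rewrite /flat_exp; case: ifP => // x0; rewrite hornerC mul1r expR_le1.
by rewrite oppr_le0 mulr_ge0 ?invr_ge0 ?ltW.
Qed.

Lemma bump_ge0 a b n x : 0 <= bump_function a b n x.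
Proof. by rewrite mulr_ge0 ?flat_exp1_ge0. Qed.

Lemma bump_le1 a b n x : bump_function a b n x <= 1.
Proof.
by rewrite -[1]mulr1 ler_pM ?flat_exp1_ge0 ?flat_exp1_le1 ?invr_gt0.
Qed.

Lemma bump_gt0 a b n x : a < x < b -> 0 < bump_function a b n x.
Proof.
move=> /andP[ax xb]; rewrite /bump_function /flat_exp !ifT; [|lra..].
by rewrite mulr_gt0// hornerC mul1r expR_gt0.
Qed.

Lemma bump_outside a b n x : ~ (a < x < b) -> bump_function a b n x = 0.
Proof.
move=> xab; rewrite /bump_function /flat_exp; case: ifPn => h1; last by rewrite mul0r.
case: ifPn => h2; last by rewrite mulr0.
by exfalso; apply: xab; apply/andP; split; lra.
Qed.

Lemma derive1_outside f a b x : (forall y, ~ (a < y < b) -> f y = 0) ->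
  x < a \/ b < x -> derive1 f x = 0.
Proof.
move=> f0 xab; apply: is_derive_derive1.
apply: is_deriveR_near (is_deriveR_cst 0 x).
case: xab => xab; near=> y; rewrite f0// => /andP[ay yb].
  have : y < a by near: y; exact: lt_nbhsl.
  lra.
have : b < y by near: y; exact: lt_nbhsr.
lra.
Unshelve. all: by end_near. Qed.

Lemma bump_cvg a b x : a < x < b -> bump_function a b n x @[n --> \oo] --> (1 : R).
Proof.
move=> /andP[ax xb].
have flat_cvg y : 0 < y -> flat_exp n.+1%:R^-1 1 y @[n --> \oo] --> (1 : R).
  move=> y0; rewrite (_ : (fun n => _) =
    (fun n : nat => expR (- (n.+1%:R^-1 * y^-1)))); last first.
    by apply/funext => n; rewrite /flat_exp y0 hornerC mul1r.
  rewrite -[X in _ --> X]expR0; apply: continuous_cvg; first exact: continuous_expR.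
  rewrite -[X in _ --> X]oppr0; apply: cvgN.
  rewrite -[X in _ --> X](mul0r y^-1); apply: cvgMl; exact: cvg_harmonic.
rewrite -[X in _ --> X]mulr1; apply: cvgM; apply: flat_cvg; lra.
Qed.

Lemma Ck_product (a b : R -> R) n : smooth a -> smooth b ->
  Ck n (fun p : R * R => a p.1 * b p.2).
Proof.
have ctsM (f g : R -> R) : continuous f -> continuous g ->
    continuous (fun p : R * R => f p.1 * g p.2).
  move=> cf cg p; apply: cvgM.
    by apply: (@continuous_comp _ _ _ fst f); [exact: cvg_fst|exact: cf].
  by apply: (@continuous_comp _ _ _ snd g); [exact: cvg_snd|exact: cg].
elim: n a b => [a b sa sb|n IH a b sa sb].
  by apply: ctsM; [exact: (sa 0%N)|exact: (sb 0%N)].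
have sM (f : R -> R) : smooth f -> smooth (derive1 f).
  by move=> sf k; have [] := sf k.+1.
have [da _] := sa 1%N; have [db _] := sb 1%N.
have dta t x := is_deriveR_Z (b x) (is_derive1 (da t)).
have dxb t x := is_deriveR_Z (a t) (is_derive1 (db x)).
split.
- by apply: ctsM; [exact: (sa 0%N)|exact: (sb 0%N)].
- move=> t x /=; have [h _] := dta t x.
  by under eq_fun do rewrite mulrC.
- by move=> t x /=; have [h _] := dxb t x.
- rewrite (_ : partial_t _ = (fun p : R * R => derive1 a p.1 * b p.2)).
    by apply: IH => //; exact: sM.
  apply/funext => -[t x]; rewrite /partial_t/= mulrC.
  under eq_fun do rewrite mulrC.
  exact: is_derive_derive1.
- rewrite (_ : partial_x _ = (fun p : R * R => a p.1 * derive1 b p.2)).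
    by apply: IH => //; exact: sM.
  by apply/funext => -[t x]; rewrite /partial_x/=; exact: is_derive_derive1.
Qed.

Lemma test_function_product (alpha beta : R -> R) a b c d :
  smooth alpha -> smooth beta ->
  (forall t, ~ (a < t < b) -> alpha t = 0) ->
  (forall x, ~ (c < x < d) -> beta x = 0) ->
  test_function (fun p : R * R => alpha p.1 * beta p.2).
Proof.
move=> sa sb a0 b0; split => [n|]; first exact: Ck_product.
have cK : compact (`[a, b]%classic `*` `[c, d]%classic : set (R * R)).
  by apply: compact_setX; exact: segment_compact.
apply: (@subclosed_compact _ _ (`[a, b]%classic `*` `[c, d]%classic)).
- exact: closed_closure.
- exact: cK.
apply: (@subset_trans _ (closure (`[a, b]%classic `*` `[c, d]%classic))).
  apply: closureS => -[t x] /= H.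
  split; rewrite /= in_itv/=.
    have [/andP[? ?]|] := pselect (a < t < b); first by apply/andP; split; exact: ltW.
    by move=> /a0 E; move: H; rewrite E mul0r eqxx.
  have [/andP[? ?]|] := pselect (c < x < d); first by apply/andP; split; exact: ltW.
  by move=> /b0 E; move: H; rewrite E mulr0 eqxx.
have /closure_id <- // : closed (`[a, b]%classic `*` `[c, d]%classic : set (R * R)).
by apply: compact_closed cK; exact: norm_hausdorff.
Qed.

End Smooth.

(** * Uniqueness of the weak derivative *)

(** The sets over whose preimage the integral of h vanishes form a Dynkin system.
    The map phi makes it possible to vary one side of a rectangle at a time. *)
Lemma integral_preimage_eq0 d d' (T : measurableType d) (T' : measurableType d')
    (R : realType) (mu : {measure set T -> \bar R}) (phi : T -> T')
    (G : set (set T')) (Q : set T) (h : T -> \bar R) :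
  measurable_fun [set: T] phi ->
  @measurable _ T' = <<s G >> -> setI_closed G ->
  measurable Q -> mu.-integrable Q h -> (\int[mu]_(x in Q) h x = 0)%E ->
  (forall A, G A -> (\int[mu]_(x in phi @^-1` A `&` Q) h x = 0)%E) ->
  forall A, measurable A -> (\int[mu]_(x in phi @^-1` A `&` Q) h x = 0)%E.
Proof.
move=> mphi GE GI mQ hi hQ hG A mA.
have mpre X : measurable X -> measurable (phi @^-1` X).
  by move=> mX; rewrite -[_ @^-1` _]setTI; exact: mphi.
apply: (@dynkin_induction _ _ G
  (fun X => \int[mu]_(x in phi @^-1` X `&` Q) h x = 0)%E GE GI); last by rewrite -GE.
- by rewrite preimage_setT setTI.
- exact: hG.
- move=> X mX hX.
  have := @integral_setU _ _ _ mu (phi @^-1` X `&` Q) (phi @^-1` (~` X) `&` Q) h.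
  rewrite -setIUl -preimage_setU setUv preimage_setT setTI hQ hX add0e => <- //.
  + by apply: measurableI => //; exact: mpre.
  + by apply: measurableI => //; apply: mpre; exact: measurableC.
  + exact: measurable_int hi.
  + rewrite disj_set2E; apply/eqP/seteqP; split => // x [[Xx _] [nXx _]].
    exact: nXx.
- move=> F mF tF hF.
  rewrite preimage_bigcup setI_bigcupl integral_bigcup//.
  + by apply: eseries0 => i _ _; exact: hF.
  + move=> i j _ _ [x [[xi _] [xj _]]]; apply: tF => //; by exists (phi x).
  + by move=> k; apply: measurableI => //; exact: mpre.
  + apply: integrableS hi => //.
      by apply: bigcupT_measurable => k; apply: measurableI => //; exact: mpre.
    by apply: bigcup_sub => k _; exact: subIsetr.
Qed.

Section Uniqueness.
Context {R : realType}.
Local Notation mu := (@lebesgue_measure R).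
Local Notation plane := (measurableTypeR R * measurableTypeR R)%type.
Local Notation mu2 := (@lebesgue_measure R \x @lebesgue_measure R)%E.
Implicit Types (a b c d : R) (h : R * R -> R).

Lemma open_interval_setI_closed :
  setI_closed [set A : set R | exists x y, A = `]x, y[%classic].
Proof.
move=> _ _ [a [b ->]] [c [d ->]]; exists (Num.max a c), (Num.min b d).
apply/seteqP; split => x /=; rewrite !in_itv/= gt_max lt_min.
  by move=> [/andP[-> ->] /andP[-> ->]].
by move=> /andP[/andP[-> ->] /andP[-> ->]].
Qed.

Lemma locally_integrable2_integrable_square h N : locally_integrable2 h ->
  mu2.-integrable (square N : set plane) (fun p => (h p)%:E).
Proof.
move=> [mh hi]; apply/integrableP; split.
  by apply: measurable_funTS; exact/measurable_EFinP.
by apply: hi; exact: compact_square.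
Qed.

Definition orthogonal_to_products h :=
  forall a b c d n,
    (\int[mu2]_p (h p * (bump_function a b n p.1 * bump_function c d n p.2))%:E = 0)%E.

(** The bumps tend to the indicator function of the rectangle and are bounded by 1. *)
Lemma orthogonal_rectangle h a b c d : locally_integrable2 h ->
  orthogonal_to_products h ->
  (\int[mu2]_(p in `]a, b[%classic `*` `]c, d[%classic) (h p)%:E = 0)%E.
Proof.
move=> hi h0.
set rect : set plane := `]a, b[%classic `*` `]c, d[%classic.
have mrect : measurable rect by apply: measurableX; exact: measurable_itv.
have [N N0 rN] : exists2 N, 0 < N & rect `<=` square N.
  exists (`|a| + `|b| + `|c| + `|d| + 1).
    by rewrite ltr_wpDl// !addr_ge0.
  move=> p [/=]; rewrite /square/= !in_itv/= => /andP[h1 h2] /andP[h3 h4].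
  have := ler_norm a; have := ler_norm b; have := ler_norm c; have := ler_norm d.
  have := ler_norm (- a); have := ler_norm (- b).
  have := ler_norm (- c); have := ler_norm (- d); rewrite !normrN.
  by move=> *; split; apply/andP; split; lra.
have [mh _] := hi.
have hr : mu2.-integrable rect (fun p => (h p)%:E).
  apply: integrableS (locally_integrable2_integrable_square N hi) => //.
  exact: measurable_square.
pose w n (p : plane) := (h p * (bump_function a b n p.1 * bump_function c d n p.2))%:E.
have mbump x y n : measurable_fun [set: R] (bump_function x y n).
  by apply: continuous_measurable_fun; exact: (smooth_bump x y n 0%N).
have mw n : measurable_fun [set: plane] (w n).
  apply/measurable_EFinP; apply: measurable_funM => //.
  apply: measurable_funM.
    exact: (measurableT_comp (mbump a b n) (@measurable_fst _ _ _ _)).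
  exact: (measurableT_comp (mbump c d n) (@measurable_snd _ _ _ _)).
have [|||||_ _] := @dominated_convergence _ _ R mu2 rect mrect w
    (fun p => (h p)%:E) (fun p => `|h p|%:E).
- by move=> n; exact: measurable_funTS.
- exact: measurable_int hr.
- apply: aeW => p [/= p1 p2]; rewrite /w.
  apply: cvg_EFin; first by near=> n.
  rewrite /comp/= -[X in _ --> X]mulr1; apply: cvgMr.
  rewrite -[X in _ --> X]mulr1; apply: cvgM; apply: bump_cvg.
    by move: p1; rewrite in_itv.
  by move: p2; rewrite in_itv.
- have := integrable_abse hr; congr (mu2.-integrable _ _).
- apply: aeW => p n _; rewrite /w lee_fin normrM ler_piMr// normrM.
  by rewrite !ger0_norm ?bump_ge0// mulr_ile1 ?bump_ge0 ?bump_le1.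
move=> /cvg_lim <- //.
apply: lim_near_cst => //; near=> n => /=.
rewrite -[RHS](h0 a b c d n) [LHS]integral_mkcond.
apply: eq_integral => p _; rewrite patchE; case: ifPn => // /negP.
rewrite inE /rect/= !in_itv/= => np.
have [p1|p1] := pselect (a < p.1 < b); last first.
  by rewrite (bump_outside n p1) mul0r mulr0.
have [p2|p2] := pselect (c < p.2 < d); last first.
  by rewrite (bump_outside n p2) !mulr0.
by exfalso; exact: np.
Unshelve. all: by end_near. Qed.

(** From open rectangles to Borel rectangles, one side at a time, and from those to all
    Borel subsets of a square; a function whose integral over every Borel set is
    zero vanishes almost everywhere. *)
Lemma orthogonal_to_products_ae0 h : locally_integrable2 h ->
  orthogonal_to_products h -> {ae mu2, forall p, h p = 0}.
Proof.
move=> hi h0; have [mh _] := hi.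
suff H (n : nat) : {ae mu2, forall p, square n%:R p -> h p = 0}.
  have := ae_foralln H; apply: filterS => p hp.
  apply: (hp (Num.truncn (`|p.1| + `|p.2|)).+1).
  have := truncnS_gt (`|p.1| + `|p.2|).
  have : 0 <= `|p.1| by []. have : 0 <= `|p.2| by [].
  by move=> *; rewrite /square/= !in_itv/= -!ler_norml; split; lra.
pose N : R := n%:R.
pose I : set R := `]- (N + 1), N + 1[%classic.
have hsq := locally_integrable2_integrable_square (N + 1) hi.
have mI : measurable (I : set (measurableTypeR R)) by exact: measurable_itv.
have Isq : I `*` I `<=` square (N + 1).
  move=> p [/=]; rewrite /I/square/= !in_itv/= => /andP[h1 h2] /andP[h3 h4].
  by split; apply/andP; split; lra.
have iA (A : set plane) : measurable A -> A `<=` I `*` I ->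
    mu2.-integrable A (fun p => (h p)%:E).
  move=> mA AI; apply: integrableS hsq => //.
    exact: measurable_square.
  exact: subset_trans Isq.
have step1 (A : set (measurableTypeR R)) c d : measurable A ->
    `]c, d[%classic `<=` I ->
    (\int[mu2]_(p in (A `&` I) `*` `]c, d[%classic) (h p)%:E = 0)%E.
  move=> mA cdI.
  have E X : fst @^-1` X `&` (I `*` `]c, d[%classic) =
      (X `&` I) `*` `]c, d[%classic :> set plane.
    by apply/seteqP; split => p /= => [[? [? ?]]|[[? ?] ?]].
  rewrite -E.
  apply: (@integral_preimage_eq0 _ _ plane (measurableTypeR R) R mu2 fst
    [set A : set R | exists x y, A = `]x, y[%classic]) => //.
  - exact: RGenOpens.measurableE.
  - exact: open_interval_setI_closed.
  - by apply: measurableX => //; exact: measurable_itv.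
  - apply: iA; first by apply: measurableX => //; exact: measurable_itv.
    by move=> p [? ?]; split => //; exact: cdI.
  - exact: orthogonal_rectangle.
  - move=> _ [a [b ->]]; rewrite E.
    have [a' [b' ->]] := open_interval_setI_closed
      (ex_intro _ a (ex_intro _ b erefl))
      (ex_intro _ (- (N + 1)) (ex_intro _ (N + 1) erefl)).
    exact: orthogonal_rectangle.
have step2 (A B : set (measurableTypeR R)) : measurable A -> measurable B ->
    (\int[mu2]_(p in (A `&` I) `*` (B `&` I)) (h p)%:E = 0)%E.
  move=> mA mB.
  have E X : snd @^-1` X `&` ((A `&` I) `*` I) =
      (A `&` I) `*` (X `&` I) :> set plane.
    by apply/seteqP; split => p /= => [[? [? ?]]|[? [? ?]]].
  have mAI : measurable (A `&` I) by exact: measurableI.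
  rewrite -E.
  apply: (@integral_preimage_eq0 _ _ plane (measurableTypeR R) R mu2 snd
    [set A : set R | exists x y, A = `]x, y[%classic]) => //.
  - exact: RGenOpens.measurableE.
  - exact: open_interval_setI_closed.
  - by apply: measurableX.
  - apply: iA; first by apply: measurableX.
    by move=> p [[_ ?] ?].
  - exact: step1.
  - move=> _ [a [b ->]]; rewrite E.
    have [a' [b' E']] := open_interval_setI_closed
      (ex_intro _ a (ex_intro _ b erefl))
      (ex_intro _ (- (N + 1)) (ex_intro _ (N + 1) erefl)).
    by rewrite E'; apply: step1 => //; rewrite -E'; exact: subIsetr.
have mII : measurable (I `*` I : set plane) by exact: measurableX.
have step3 (A : set plane) : measurable A ->
    (\int[mu2]_(p in A `&` (I `*` I)) (h p)%:E = 0)%E.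
  move=> mA.
  apply: (@integral_preimage_eq0 _ _ plane plane R mu2 id
    [set A `*` B | A in measurable & B in measurable]) => //.
  - exact: measurable_prod_measurableType.
  - move=> _ _ [A1 mA1 [B1 mB1 <-]] [A2 mA2 [B2 mB2 <-]].
    exists (A1 `&` A2); first exact: measurableI.
    exists (B1 `&` B2); first exact: measurableI.
    by rewrite setXI.
  - exact: iA.
  - by have := @step2 setT setT measurableT measurableT; rewrite !setTI.
  - move=> _ [A1 mA1 [B1 mB1 <-]]; rewrite preimage_id.
    by rewrite -setXI; exact: step2.
have : ae_eq mu2 (I `*` I : set plane) (fun p => (h p)%:E) (cst 0%E).
  apply: integral_ae_eq => //; first exact: iA.
  move=> E EI mE; rewrite integral_cst// mul0e.
  by have := step3 E mE; rewrite setIidl.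
apply: filterS => p hp [/=]; rewrite !in_itv/= => /andP[h1 h2] /andP[h3 h4].
have [] : (h p)%:E = 0%E; last by [].
by apply: hp; split; rewrite /I/= in_itv/= /N; apply/andP; split; lra.
Qed.

Lemma weak_partial_x_unique (u v w : R * R -> R) :
  weak_partial_x u v -> weak_partial_x u w -> {ae mu2, forall p, v p = w p}.
Proof.
move=> [_ vi vE] [_ wi wE].
have [mv _] := vi; have [mw _] := wi.
have hi : locally_integrable2 (fun p => v p - w p).
  have mvw : measurable_fun [set: plane] (fun p => v p - w p) by exact: measurable_funB.
  apply/locally_integrable2P => // N.
  have /integrableP[_] := integrableB (measurable_square N)
    (locally_integrable2_integrable_square N vi)
    (locally_integrable2_integrable_square N wi).
  by [].
have : {ae mu2, forall p, v p - w p = 0}.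
  apply: orthogonal_to_products_ae0 => // a b c d n.
  pose F (p : R * R) := bump_function a b n p.1 * bump_function c d n p.2.
  have tF : test_function F.
    by apply: (@test_function_product _ _ _ a b c d); [exact: smooth_bump..|
      exact: bump_outside|exact: bump_outside].
  have [M M0 [[cF _ _ _ _] F0 _ _]] := test_function_C1 tF.
  have i1 := integrable_mul_vanishing vi cF F0.
  have i2 := integrable_mul_vanishing wi cF F0.
  transitivity (\int[mu2]_p ((v p * F p)%:E - (w p * F p)%:E))%E.
    by apply: eq_integral => p _; rewrite -EFinB mulrBl.
  rewrite integralB//.
  have : (- (\int[mu2]_p (v p * F p)%:E) = - (\int[mu2]_p (w p * F p)%:E))%E.
    by rewrite -vE// -wE.
  move=> /oppe_inj ->; rewrite subee//.
  exact: integrable_fin_num i2.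
apply: filterS; first exact: (ae_filter_ringOfSetsType mu2).
by move=> p /subr0_eq.
Qed.

End Uniqueness.

(** * Cuspon and stumpon profiles *)

Section Profile.
(** A cuspon is handled as the stumpon whose plateaus have length l = 0; this is why
    the relation between the parameters is assumed only for l > 0. *)
Context {R : realType}.
Variables (M s m L : R) (phi : R -> R) (l : R) (psi : R -> R).
Local Notation z := (s - M - m).

Hypothesis params : cuspon_parameters M s m.
Hypothesis phiP : cuspon_profile M s m L phi.
Hypothesis l0 : 0 <= l.
Hypothesis psiP : stumpon_profile s L l phi psi.
Hypothesis plateau_condition : 0 < l -> - (M * m) - (M + m) * z = s ^+ 2.

Let B := M * m + (M + m) * z.
Let Q (y : R) := (M - y) * (y - m) * (y - z).
Let T := 2 * (L + l).

Let L0 : 0 < L. Proof. by case: phiP. Qed.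
Let cphi : continuous phi. Proof. by case: phiP => _ []. Qed.
Let phi_even x : phi (- x) = phi x.
Proof. by case: phiP => _ [_ [_ [_ [_ [+ _]]]]]; apply. Qed.
Let phi_periodic x : phi (x + 2 * L) = phi x.
Proof. by case: phiP => _ [_ [+ _]]; apply. Qed.
Let phi_0 : phi 0 = s. Proof. by case: phiP => _ [_ [_ [_ [_ [_ []]]]]]. Qed.
Let phi_L : phi L = m. Proof. by case: phiP => _ [_ [_ [_ [_ [_ [_ []]]]]]]. Qed.

Let off_cusps_arch x : 0 < `|x| < 2 * L -> off_cusps L x.
Proof.
move=> /andP[x0 x2] k; apply/eqP => xE; move: x0 x2; rewrite xE.
have L2 : 0 < 2 * L by rewrite mulr_gt0.
rewrite normrM (gtr0_norm L2) => h1.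
rewrite -[X in _ < X]mulr1 ltr_pM2l// -intr_norm -[1]/(1%:~R) ltr_int.
case: (k =P 0) h1 => [->|/eqP k0 _]; first by rewrite normr0 mulr0 ltxx.
by rewrite ltNge -gtz0_ge1 normr_gt0 k0.
Qed.

Let phi_derivable n (x : R) : 0 < `|x| < 2 * L -> derivable (derive1n n phi) x 1.
Proof.
by move=> /off_cusps_arch h; case: phiP => _ [_ [_ [+ _]]]; apply.
Qed.

Let phi_deriv (x : R) : 0 < `|x| < 2 * L -> is_derive x 1 phi (derive1 phi x).
Proof. by move=> /(@phi_derivable 0%N) ?; exact: is_derive1. Qed.

Let phi_deriv2 (x : R) : 0 < `|x| < 2 * L ->
  is_derive x 1 (derive1 phi) (derive1 (derive1 phi) x).
Proof. by move=> /(@phi_derivable 1%N) ?; exact: is_derive1. Qed.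

Let arch_width (x : R) : 0 < `|x| < L -> 0 < `|x| < 2 * L.
Proof. by have := L0; lra. Qed.

Let phi_deriv_neq0 (x : R) : 0 < `|x| < L -> derive1 phi x != 0.
Proof.
have pos y : 0 < y < L -> derive1 phi y != 0.
  move=> yL; have [_ [_ [_ [_ [_ [_ [_ [_ [_ [neg posi]]]]]]]]]] := phiP.
  case: params => -[_ sm _]; first by rewrite lt_eqF// neg.
  by rewrite gt_eqF// posi.
have [x0|x0] := leP 0 x; first by rewrite ger0_norm//; exact: pos.
rewrite ltr0_norm// => xL.
have xL' : 0 < `|- x| < L by rewrite gtr0_norm//; lra.
have d1 := phi_deriv (arch_width xL').
have d2 := @is_deriveR_comp _ phi -%R x _ _ d1 (is_deriveR_N (is_deriveR_id x)).
have E : (fun y => phi (- y)) = phi by apply/funext.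
rewrite E in d2; rewrite (is_derive_derive1 d2) mulrN1 oppr_eq0.
by apply: pos; lra.
Qed.

(** If phi x were s, the quotient in the profile equation would be 0 by convention,
    whereas phi' does not vanish on an open arch. *)
Let phi_ode (x : R) : 0 < `|x| < L ->
  (s - phi x) * derive1 phi x ^+ 2 = Q (phi x) /\ s - phi x != 0.
Proof.
move=> xL; have [_ [_ [_ [_ [ode _]]]]] := phiP.
have /eqP ode_x := ode x (off_cusps_arch (arch_width xL)).
have p0 := phi_deriv_neq0 xL.
have s0 : s - phi x != 0.
  apply/eqP => E; move: ode_x; rewrite E invr0 mulr0 sqrf_eq0.
  by rewrite (negPf p0).
by split=> //; rewrite (eqP ode_x) mulrC divfK.
Qed.

Let QE y : Q y = - y ^+ 3 + s * y ^+ 2 - B * y + M * m * z.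
Proof. by rewrite /Q /B; ring. Qed.

(** The derivative of the profile equation, divided by phi'. *)
Let phi_second_order (x : R) : 0 < `|x| < L ->
  2 * (s - phi x) * derive1 (derive1 phi) x =
  derive1 phi x ^+ 2 - 3 * phi x ^+ 2 + 2 * s * phi x - B.
Proof.
move=> xL; have xL2 := arch_width xL.
have d1 := phi_deriv xL2; have d2 := phi_deriv2 xL2.
set p := derive1 phi x in d1 d2 *; set p' := derive1 (derive1 phi) x in d2 *.
have dQ := is_deriveR_M (is_deriveR_M (is_deriveR_B (is_deriveR_cst M x) d1)
  (is_deriveR_B d1 (is_deriveR_cst m x))) (is_deriveR_B d1 (is_deriveR_cst z x)).
have dE := is_deriveR_M (is_deriveR_B (is_deriveR_cst s x) d1) (is_deriveR_M d2 d2).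
have EQ : \forall y \near x,
    (s - phi y) * (derive1 phi y * derive1 phi y) =
    (M - phi y) * (phi y - m) * (phi y - z).
  have cn : {for x, continuous (fun y : R => `|y|)} by exact: norm_continuous.
  case/andP: xL => x0 xL.
  near=> y; have [] := @phi_ode y; last by rewrite expr2.
  apply/andP; split; near: y; first exact: (cvgr_gt `|x| cn).
  exact: (cvgr_lt `|x| cn).
have E := is_derive_derive1 (is_deriveR_near EQ dE).
rewrite (is_derive_derive1 dQ) in E.
have p0 : p != 0 by exact: phi_deriv_neq0.
apply: (mulfI p0); move: E; rewrite -/p /B => E.
lra.
Unshelve. all: by end_near. Qed.

Let psi_periodic (k : int) x : psi (x + T * k%:~R) = psi x.
Proof.
have [per _ _] := psiP.
have perN n y : psi (y + T * n%:R) = psi y by rewrite mulr_natr; exact: periodicn.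
case: k => n; first exact: perN.
rewrite -[in RHS](subrK (T * n.+1%:R) x) perN; congr psi.
by rewrite NegzE mulrNz mulrN.
Qed.

(** Beyond l + L the folded profile would be decided by the next period; since phi is
    even and periodic, the formula stays valid up to l + 2 L.  It therefore holds on
    overlapping open intervals. *)
Let psi_fold (k : int) x : `|x - T * k%:~R| <= l + 2 * L ->
  psi x = phi (Num.max 0 (`|x - T * k%:~R| - l)).
Proof.
have [_ psi1 psi2] := psiP.
set y := x - T * k%:~R.
have -> : psi x = psi y by rewrite -(psi_periodic k y) /y subrK.
clearbody y; move=> yl.
have [y1|y1] := ltP `|y| l.
  by rewrite psi1// -phi_0 max_l// subr_le0 ltW.
rewrite max_r ?subr_ge0//.
have [y2|y2] := leP `|y| (l + L); first by rewrite psi2// y1.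
have [y' yy' ny'] : exists2 y', psi y' = psi y & `|y'| = T - `|y|.
  have LL := L0; have ll := l0; have TE : T = 2 * (L + l) by [].
  have [y0|y0] := leP 0 y.
    have ny : `|y| = y by rewrite ger0_norm.
    exists (y - T); first by rewrite -(psi_periodic 1) mulr1 subrK.
    by rewrite ny in yl y2 *; rewrite ler0_norm; [ring|lra].
  have ny : `|y| = - y by rewrite ltr0_norm.
  exists (y + T); first by rewrite -(psi_periodic 1 y) mulr1.
  by rewrite ny in yl y2 *; rewrite ger0_norm; [ring|lra].
rewrite -yy' psi2; last by have ll := l0; rewrite ny' /T; apply/andP; split; lra.
rewrite ny' -(phi_even (`|y| - l)) -(phi_periodic (- _)); congr phi.
by rewrite /T; ring.
Qed.

Let fold_index x : exists k : int, `|x - T * k%:~R| <= L + l.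
Proof.
have T0 : 0 < T by rewrite mulr_gt0// ltr_wpDr.
exists (Num.floor ((x + (L + l)) / T)).
have := floor_itv ((x + (L + l)) / T); set k := Num.floor _ => /andP[].
rewrite ler_pdivlMr// ltr_pdivrMr// intrD mulrDl mul1r => h1 h2.
by rewrite ler_norml; apply/andP; rewrite [T * _]mulrC /T in h1 h2 *; split; lra.
Qed.

Let plateau x := exists k : int, `|x - T * k%:~R| < l.

(** Near x the profile is a translate of one of the two arches next to the cusp of phi
    at the origin. *)
Let branch (c x : R) :=
  0 < `|x - c| < L /\ \forall y \near x, psi y = phi (y - c).

Let psi_plateau x : plateau x -> psi x = s.
Proof.
move=> [k xk]; rewrite (@psi_fold k); last by have := L0; lra.
by rewrite max_l// subr_le0 ltW.
Qed.

Let continuous_dist (c : R) : continuous (fun x : R => `|x - c|).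
Proof.
by move=> x; apply: cvg_norm; apply: cvgB; [exact: cvg_id|exact: cvg_cst].
Qed.

Let plateau_near x : plateau x -> \forall y \near x, plateau y.
Proof.
move=> [k xk]; near=> y; exists k; near: y.
exact: (cvgr_lt _ (@continuous_dist (T * k%:~R) x)).
Unshelve. all: by end_near. Qed.

Let branch_near c x : branch c x -> \forall y \near x, branch c y.
Proof.
move=> [/andP[h1 h2] /nbhs_interior h3]; near=> y; split; last by near: y.
apply/andP; split; near: y.
  exact: (cvgr_gt _ (@continuous_dist c x)).
exact: (cvgr_lt _ (@continuous_dist c x)).
Unshelve. all: by end_near. Qed.

Let branch_psi c x : branch c x -> psi x = phi (x - c).
Proof. by move=> [_ /nbhs_singleton]. Qed.

Let profile_trichotomy x : [\/ plateau x, exists c, branch c x |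
  (s - psi x) * Q (psi x) = 0 /\
  exists k : int, `|x - T * k%:~R| = l \/ `|x - T * k%:~R| = l + L].
Proof.
have LL := L0; have ll := l0; have [k xk] := fold_index x.
have psix : psi x = phi (Num.max 0 (`|x - T * k%:~R| - l)) by apply: psi_fold; lra.
have [xl|lx|xl] := ltgtP `|x - T * k%:~R| l.
- by apply: Or31; exists k.
- have [xL|Lx|xL] := ltgtP `|x - T * k%:~R| (l + L).
  + apply: Or32.
    have [y0|y0] := leP 0 (x - T * k%:~R).
      have xk0 : 0 < x - T * k%:~R by move: lx; rewrite ger0_norm//; lra.
      exists (T * k%:~R + l); split.
        by move: lx xL; rewrite opprD addrA ger0_norm// => ? ?; rewrite ger0_norm; lra.
      near=> y.
      have y1 : T * k%:~R < y.
        by near: y; apply: lt_nbhsr; lra.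
      have y2 : `|y - T * k%:~R| < l + L.
        by near: y; exact: (cvgr_lt _ (@continuous_dist (T * k%:~R) x)).
      have y3 : l < `|y - T * k%:~R|.
        by near: y; exact: (cvgr_gt _ (@continuous_dist (T * k%:~R) x)).
      rewrite (@psi_fold k); last lra.
      rewrite max_r; last by lra.
      by rewrite ger0_norm; [congr phi; ring|lra].
    exists (T * k%:~R - l); split.
      move: lx xL; rewrite opprB addrA ltr0_norm// => ? ?.
      by rewrite ltr0_norm; lra.
    near=> y.
    have y1 : y < T * k%:~R by near: y; apply: lt_nbhsl; lra.
    have y2 : `|y - T * k%:~R| < l + L.
      by near: y; exact: (cvgr_lt _ (@continuous_dist (T * k%:~R) x)).
    have y3 : l < `|y - T * k%:~R|.
      by near: y; exact: (cvgr_gt _ (@continuous_dist (T * k%:~R) x)).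
    rewrite (@psi_fold k); last lra.
    rewrite max_r; last by lra.
    by rewrite ltr0_norm; [rewrite -phi_even; congr phi; ring|lra].
  + by exfalso; lra.
  + apply: Or33; split; last by exists k; right.
    rewrite psix xL [l + L]addrC addrK max_r ?ltW// phi_L /Q subrr.
    by rewrite mulr0 mul0r mulr0.
- apply: Or33; split; last by exists k; left.
  by rewrite psix xl subrr max_l// phi_0 subrr mul0r.
Unshelve. all: by end_near. Qed.

(** Cusps, ends of plateaus, and points where the profile takes the value m.  The last
    ones are smooth points, but phi' = 0 there, so that the differentiated profile
    equation says nothing about phi''.  At all of them (s - psi) Q(psi) = 0. *)
Definition profile_singular_set : set R :=
  [set x | (s - psi x) * Q (psi x) = 0 /\ ~ plateau x].
Local Notation S := profile_singular_set.

(** The value 0 on the singular set makes (s - psi) g continuous there. *)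
Definition profile_derivative (x : R) : R :=
  if `[< S x >] then 0 else derive1 psi x.
Local Notation g := profile_derivative.

Let off_singular x : ~ S x -> plateau x \/ exists c, branch c x.
Proof.
move=> nSx; have [?|?|[h1 _]] := profile_trichotomy x; [by left|by right|].
by left; apply: contrapT => np; apply: nSx.
Qed.

Let branch_facts c x : branch c x -> [/\ ~ S x, g x = derive1 phi (x - c) &
  is_derive x 1 psi (derive1 phi (x - c))].
Proof.
move=> bx; have [xL hn] := bx.
have [ode s0] := phi_ode xL; have p0 := phi_deriv_neq0 xL.
have nSx : ~ S x.
  move=> [/eqP + _]; rewrite (branch_psi bx) -ode !mulf_eq0 (negPf s0)/=.
  by rewrite (negPf p0).
have dpsi : is_derive x 1 psi (derive1 phi (x - c)).
  apply: is_deriveR_near (is_deriveR_shift (phi_deriv (arch_width xL))).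
  by move: hn; apply: filterS => y ->.
split=> //; rewrite /profile_derivative asboolF//.
exact: is_derive_derive1.
Qed.

Let plateau_facts x : plateau x -> [/\ ~ S x, g x = 0 & is_derive x 1 psi 0].
Proof.
move=> px; have nSx : ~ S x by case.
have dpsi : is_derive x 1 psi 0.
  apply: is_deriveR_near (is_deriveR_cst s x).
  by move: (plateau_near px); apply: filterS => y /psi_plateau ->.
split=> //; rewrite /profile_derivative asboolF//.
exact: is_derive_derive1.
Qed.

Let continuous_psi : continuous psi.
Proof.
move=> x; have [k xk] := fold_index x; have LL := L0.
pose h y := phi (Num.max 0 (`|y - T * k%:~R| - l)).
have ch : {for x, continuous h}.
  apply: continuous_comp; last exact: cphi.
  apply: (@continuous_max _ _ (fun _ : R => 0) (fun y : R => `|y - T * k%:~R| - l)).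
    exact: cvg_cst.
  by apply: cvgB; [exact: continuous_dist|exact: cvg_cst].
have E : \forall y \near x, h y = psi y.
  near=> y; rewrite (@psi_fold k)// ltW//; near: y.
  by apply: (cvgr_lt _ (@continuous_dist (T * k%:~R) x)); lra.
exact: continuous_at_near E ch.
Unshelve. all: by end_near. Qed.

Let continuous_derivative_off_singular x : ~ S x ->
  continuous_derivative_at psi g x.
Proof.
move=> /off_singular[px|[c bx]].
  have [_ gx dx] := plateau_facts px; split; first by rewrite gx.
  have E : \forall y \near x, 0 = g y.
    by move: (plateau_near px); apply: filterS => y /plateau_facts[_ ->].
  by apply: continuous_at_near E _; exact: cvg_cst.
have [_ gx dx] := branch_facts bx; split; first by rewrite gx.
have E : \forall y \near x, derive1 phi (y - c) = g y.
  by move: (branch_near bx); apply: filterS => y /branch_facts[_ ->].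
apply: continuous_at_near E _.
have cd : {for x - c, continuous (derive1 phi)}.
  by apply: is_deriveR_continuous (phi_deriv2 (arch_width _)); case: bx.
apply: (@continuous_comp _ _ _ (fun y : R => y - c) (derive1 phi)) => //.
by apply: cvgB; [exact: cvg_id|exact: cvg_cst].
Qed.

Let open_off_singular : open (~` S).
Proof.
rewrite openE => x /= /off_singular[px|[c bx]]; rewrite /interior.
  by move: (plateau_near px); apply: filterS => y /plateau_facts[].
by move: (branch_near bx); apply: filterS => y /branch_facts[].
Qed.

Let g_singular x : S x -> g x = 0.
Proof. by move=> Sx; rewrite /profile_derivative asboolT. Qed.

Let g_measurable : measurable_fun [set: R] g.
Proof.
rewrite -(setUv S); apply/measurable_funU.
- by rewrite -(setCK S); apply: measurableC; exact: open_measurable.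
- exact: open_measurable.
split.
  have m0 : measurable_fun S (cst 0 : R -> R) by exact: measurable_cst.
  by apply: eq_measurable_fun m0 => x; rewrite inE => /g_singular ->.
apply: open_continuous_measurable_fun => // x; rewrite inE => nSx.
by have [] := continuous_derivative_off_singular nSx.
Qed.

(** The profile equation multiplied by s - psi has no singularity, and it holds on
    plateaus as well. *)
Let sqr_gradient x :
  pressure_gradient s psi g x ^+ 2 = (s - psi x) * Q (psi x).
Proof.
rewrite /pressure_gradient.
have [Sx|/off_singular[px|[c bx]]] := pselect (S x).
- by case: (Sx) => -> _; rewrite g_singular// mulr0 expr0n.
- have [_ -> _] := plateau_facts px.
  by rewrite psi_plateau// subrr mulr0 mul0r expr0n.
- have [_ -> _] := branch_facts bx; rewrite (branch_psi bx).
  by case: bx => /phi_ode[<- _] _; ring.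
Qed.

Let singular_locally_finite : locally_finite S.
Proof.
move=> a b.
pose N := (Num.truncn ((`|a| + `|b| + (L + l)) / T)).+1.
pose ks : seq int := [seq Posz i | i <- iota 0 N.+1] ++ [seq Negz i | i <- iota 0 N.+1].
pose pts (k : int) : seq R := [:: T * k%:~R + l; T * k%:~R - l;
  T * k%:~R + (l + L); T * k%:~R - (l + L)].
exists (flatten [seq pts k | k <- ks]) => x xab Sx.
have [px|[c bx]|[_ [k xk]]] := profile_trichotomy x.
- by case: Sx.
- by have [] := branch_facts bx.
have LL := L0; have ll := l0.
have T0 : 0 < T by rewrite /T; lra.
apply/flattenP; exists (pts k); last first.
  have : x - T * k%:~R = `|x - T * k%:~R| \/ x - T * k%:~R = - `|x - T * k%:~R|.
    by have [h|h] := leP 0 (x - T * k%:~R); [left; rewrite ger0_norm|right; rewrite ltr0_norm// opprK].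
  rewrite /pts !inE.
  case: xk => -> [] /eqP; rewrite subr_eq => /eqP ->.
  + by rewrite [l + T * _]addrC eqxx.
  + by rewrite [- l + T * _]addrC eqxx orbT.
  + by rewrite [l + L + T * _]addrC eqxx !orbT.
  + by rewrite [- (l + L) + T * _]addrC eqxx !orbT.
apply/mapP; exists k => //.
have kT : `|k%:~R| * T <= `|a| + `|b| + (L + l).
  rewrite -{1}(gtr0_norm T0) -normrM mulrC.
  have xk' : `|x - T * k%:~R| <= L + l by case: xk => ->; lra.
  have := ler_distD x 0 (T * k%:~R); rewrite !sub0r !normrN => h.
  apply: (le_trans h); rewrite lerD//.
  case/andP: xab => ax xb; rewrite ler_norml.
  have := ler_norm (- a); have := ler_norm b; have : 0 <= `|a| by []; have : 0 <= `|b| by [].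
  by rewrite normrN => *; apply/andP; split; lra.
have kN : `|k%:~R : R| < N%:R.
  apply: le_lt_trans (truncnS_gt _); by rewrite ler_pdivlMr.
rewrite mem_cat; apply/orP.
have kN' : (`|k|%N < N)%N.
  by rewrite -(ltr_nat R) natr_absz intr_norm.
case: k {xk kT kN} kN' => n nN; [left|right]; apply/mapP; exists n => //.
  by rewrite mem_iota /= add0n ltnW.
by rewrite mem_iota/= add0n; move: nN; rewrite /absz => /ltnW/ltnW; rewrite ltnS.
Qed.

Let psi_bounded : exists K, forall x, `|psi x| <= K.
Proof.
have [C C0 phiC] := continuous_segment_bounded 0 L cphi.
exists C => x; have [k xk] := fold_index x; have LL := L0.
rewrite (@psi_fold k); last lra.
by apply: phiC; rewrite le_max lexx/= ge_max ltW//=; lra.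
Qed.

Let cubic_bounded K y : `|y| <= K -> (s - y) * Q y <=
  (`|s| + K) * ((`|M| + K) * (K + `|m|) * (K + `|z|)).
Proof.
move=> yK; apply: le_trans (ler_norm _) _; rewrite /Q !normrM.
have tri (p q : R) : `|p - q| <= `|p| + `|q| by exact: ler_normB.
by rewrite !ler_pM ?mulr_ge0//; apply: le_trans (tri _ _) _; rewrite lerD.
Qed.

(** At a singular point the modulus of the gradient is the square root of a continuous
    function that vanishes there. *)
Let gradient_continuous : continuous (pressure_gradient s psi g).
Proof.
move=> x; have [Sx|nSx] := pselect (S x); last first.
  have [_ cg] := continuous_derivative_off_singular nSx.
  by apply: cvgM => //; apply: cvgB; [exact: cvg_cst|exact: continuous_psi].
have r0 : pressure_gradient s psi g x = 0.
  by rewrite /pressure_gradient g_singular// mulr0.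
rewrite /continuous_at r0; apply: norm_cvg0.
have -> : (fun y => `|pressure_gradient s psi g y|) =
    (fun y => Num.sqrt ((s - psi y) * Q (psi y))).
  by apply/funext => y; rewrite -sqr_gradient sqrtr_sqr.
have cB (k : R) : {for x, continuous (fun y => psi y - k)}.
  by apply: cvgB; [exact: continuous_psi|exact: cvg_cst].
have cB' (k : R) : {for x, continuous (fun y => k - psi y)}.
  by apply: cvgB; [exact: cvg_cst|exact: continuous_psi].
have csqrt : {for x, continuous (fun y => Num.sqrt ((s - psi y) * Q (psi y)))}.
  apply: (@continuous_comp _ _ _ (fun y => (s - psi y) * Q (psi y)) Num.sqrt).
    by apply: cvgM; [exact: cB'|apply: cvgM; [apply: cvgM|]];
      [exact: cB'|exact: cB|exact: cB].
  exact: sqrt_continuous.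
by move: csqrt; rewrite /prop_for /continuous_at; case: (Sx) => -> _; rewrite sqrtr0.
Qed.

Let gradient_bounded : exists K, forall x, `|pressure_gradient s psi g x| <= K.
Proof.
have [K psiK] := psi_bounded.
exists (1 + (`|s| + K) * ((`|M| + K) * (K + `|m|) * (K + `|z|))) => x.
apply: le_trans (_ : 1 + pressure_gradient s psi g x ^+ 2 <= _); last first.
  by rewrite lerD2l sqr_gradient; exact: cubic_bounded.
have := sqr_ge0 (`|pressure_gradient s psi g x| - 2^-1).
rewrite sqrrB real_normK ?num_real//.
have : 0 <= `|pressure_gradient s psi g x| by []. lra.
Qed.

(** On an arch this is the second order equation; on a plateau it is the relation
    B = - s ^ 2. *)
Let gradient_derivative x : ~ S x ->
  is_derive x 1 (pressure_gradient s psi g)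
    (profile_pressure s B psi x - pressure_source psi g x).
Proof.
move=> /off_singular[px|[c bx]].
  have [_ gx _] := plateau_facts px.
  have E : \forall y \near x, 0 = pressure_gradient s psi g y.
    move: (plateau_near px); apply: filterS => y /plateau_facts[_ gy _].
    by rewrite /pressure_gradient gy mulr0.
  apply: is_deriveR_eq (is_deriveR_near E (is_deriveR_cst 0 x)) _.
  rewrite /profile_pressure /pressure_source gx psi_plateau//.
  have lpos : 0 < l by case: px => k; exact: le_lt_trans.
  have BE : B = - s ^+ 2 by rewrite -plateau_condition// /B; ring.
  by rewrite BE; field.
have [_ gx _] := branch_facts bx; have [xL _] := bx.
have d1 := is_deriveR_shift (phi_deriv (arch_width xL)).
have d2 := is_deriveR_shift (phi_deriv2 (arch_width xL)).
have d3 := is_deriveR_M (is_deriveR_B (is_deriveR_cst s x) d1) d2.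
have E : \forall y \near x, (s - phi (y - c)) * derive1 phi (y - c) =
    pressure_gradient s psi g y.
  move: (branch_near bx); apply: filterS => y by_.
  by have [_ gy _] := branch_facts by_; rewrite /pressure_gradient gy (branch_psi by_).
apply: is_deriveR_eq (is_deriveR_near E d3) _.
have so := phi_second_order xL.
rewrite /profile_pressure /pressure_source gx (branch_psi bx).
move: so; set p'' := derive1 (derive1 phi) _; lra.
Qed.

Lemma stumpon_wave_profile : wave_profile s B S psi g.
Proof.
split; [exact: continuous_psi|exact: psi_bounded|exact: g_measurable|
  exact: singular_locally_finite|exact: continuous_derivative_off_singular|
  exact: gradient_continuous|exact: gradient_bounded|exact: gradient_derivative].
Qed.

Lemma flux_defect_arch y : ~ S y -> (forall k : int, l <= `|y - T * k%:~R|) ->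
  flux_defect s B psi g y = - (M * m * z).
Proof.
move=> /off_singular[[k yk] /(_ k)|[c by_] _]; first by rewrite leNgt yk.
have [_ gy _] := branch_facts by_; have [/phi_ode[ode _] _] := by_.
move: ode; rewrite QE /flux_defect /profile_pressure gy (branch_psi by_).
set p := derive1 phi _; set f := phi _ => ode.
rewrite (_ : _ - _ = - ((s - f) * p ^+ 2) - f ^+ 3 + s * f ^+ 2 - B * f).
  by rewrite ode; ring.
by field.
Qed.

Lemma flux_defect_plateau y : `|y| < l ->
  flux_defect s B psi g y = s ^+ 3.
Proof.
move=> yl; have py : plateau y by exists 0; rewrite mulr0 subr0.
have lpos : 0 < l by exact: le_lt_trans yl.
have [_ gy _] := plateau_facts py.
have BE : B = - s ^+ 2 by rewrite -plateau_condition// /B; ring.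
by rewrite /flux_defect /profile_pressure gy psi_plateau// BE; field.
Qed.

(** The difference of the two values is Q(s), and s is not a root of Q. *)
Lemma plateau_flux_neq : 0 < l -> s ^+ 3 != - (M * m * z).
Proof.
move=> lpos; have BE : B = - s ^+ 2 by rewrite -plateau_condition// /B; ring.
rewrite -subr_eq0.
have -> : s ^+ 3 - - (M * m * z) = Q s by rewrite QE BE; ring.
rewrite /Q !mulf_neq0// subr_eq0.
- by case: params => -[_ _ sM]; rewrite ?(gt_eqF sM) ?(lt_eqF sM).
- by case: params => -[_ ms _]; rewrite ?(gt_eqF ms) ?(lt_eqF ms).
- case: params => -[zm ms _]; first by rewrite gt_eqF// (lt_trans zm).
  by rewrite lt_eqF// (lt_trans ms).
Qed.

End Profile.

(** * Changing the weak derivative on a null set *)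

Lemma ae_imply d (T : measurableType d) (R : realType)
    (mu : {measure set T -> \bar R}) (A B : T -> Prop) :
  (forall x, A x -> B x) -> {ae mu, forall x, A x} -> {ae mu, forall x, B x}.
Proof.
move=> AB [N [mN N0 AN]]; exists N; split => // x nB.
by apply: AN => /AB.
Qed.

Section AlmostEverywhere.
Context {R : realType}.
Local Notation mu := (@lebesgue_measure R).
Local Notation plane := (measurableTypeR R * measurableTypeR R)%type.
Local Notation mu2 := (@lebesgue_measure R \x @lebesgue_measure R)%E.

Lemma ae_slices (A : R * R -> Prop) : {ae mu2, forall p, A p} ->
  {ae mu, forall t, {ae mu, forall x, A (t, x)}}.
Proof.
move=> [N [mN N0 AN]].
have mx : measurable_fun setT (fun t => mu (xsection N t)).
  exact: measurable_fun_xsection.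
have H : ae_eq mu setT (fun t => mu (xsection N t)) (cst 0%E).
  apply/ae_eq_integral_abs => //.
  rewrite -[RHS]N0; apply: eq_integral => t _.
  by rewrite gee0_abs.
apply: ae_imply H => t /(_ I) /= Nt; exists (xsection N t); split => //.
  exact: measurable_xsection.
move=> x nA; rewrite /xsection /= inE; exact: AN.
Qed.

Lemma ae_fst (A : R -> Prop) : {ae mu, forall t, A t} ->
  {ae mu2, forall p, A p.1}.
Proof.
move=> [N [mN N0 AN]]; exists (N `*` setT); split.
- exact: measurableX.
- by rewrite product_measure1E// [X in (X * _)%E]N0 mul0e.
- by move=> p nA; split => //; exact: AN.
Qed.

(** For almost every t the slices of v and w agree almost everywhere, and then P is the
    same at every x. *)
Lemma P_ae (u v w : R * R -> R) :
  measurable_fun [set: plane] u -> measurable_fun [set: plane] v ->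
  measurable_fun [set: plane] w -> {ae mu2, forall p, v p = w p} ->
  {ae mu, forall t, forall x, P u v (t, x) = P u w (t, x)}.
Proof.
move=> mu_ mv mw /ae_slices.
have mP (v' : R * R -> R) t x : measurable_fun [set: plane] v' ->
    measurable_fun [set: R] (fun y => (P_integrand u v' t x y)%:E).
  move=> mv'; apply/measurable_EFinP; apply: measurable_funM.
    apply: continuous_measurable_fun => y; apply: cvgMr.
    apply: continuous_comp; last exact: continuous_expR.
    by apply: cvgN; apply: cvg_norm; apply: cvgB; [exact: cvg_cst|exact: cvg_id].
  apply: measurable_funD; first by apply: measurable_funX; exact: measurable_fun_pair2.
  by apply: measurable_funM => //; apply: measurable_funX; exact: measurable_fun_pair2.
apply: ae_imply => t vw x; rewrite /P /Rintegral /=; congr fine.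
apply: ae_eq_integral => //; [exact: mP|exact: mP|].
apply: ae_imply vw => y vw _;
  by rewrite /P_integrand vw.
Qed.

(** The equation does not depend on the representative of the weak derivative. *)
Lemma weak_equation_ae (u v w Phi : R * R -> R) :
  has_weak_formulation u v -> has_weak_formulation u w -> test_function Phi ->
  (\int[mu2]_p (density u v p * partial_t Phi p + flux u v p * partial_x Phi p)%:E =
   \int[mu2]_p (density u w p * partial_t Phi p + flux u w p * partial_x Phi p)%:E)%E.
Proof.
move=> [vx _ [mdv _] [mfv _]] [wx _ [mdw _] [mfw _]] tP.
have [N N0 [[cP _ _ cPt cPx] _ _ _]] := test_function_C1 tP.
have mt := @continuous_measurable_plane _ (partial_t Phi) cPt.
have mx := @continuous_measurable_plane _ (partial_x Phi) cPx.
have vw := weak_partial_x_unique vx wx.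
case: vx wx => -[mu_ _] [mv _] _ [_ [mw _] _].
have /ae_fst Pvw := P_ae mu_ mv mw vw.
apply: ae_eq_integral => //.
- by apply/measurable_EFinP; apply: measurable_funD; exact: measurable_funM.
- by apply/measurable_EFinP; apply: measurable_funD; exact: measurable_funM.
move: vw Pvw; apply: filterS2; first exact: (ae_filter_ringOfSetsType mu2).
by move=> [t x] vw Pvw _; rewrite /density /flux vw Pvw.
Qed.

Lemma integral_pos_neq0 (w : R -> R) a b : a < b -> measurable_fun [set: R] w ->
  (forall t, 0 <= w t) -> (forall t, a < t < b -> 0 < w t) ->
  (\int[mu]_t (w t)%:E)%E <> 0%E.
Proof.
move=> ab mw w0 wab wI.
have : ae_eq mu setT (EFin \o w) (cst 0%E).
  apply/ae_eq_integral_abs => //; first exact/measurable_EFinP.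
  by rewrite -[RHS]wI; apply: eq_integral => t _; rewrite /= ger0_norm.
move=> [N [mN N0 AN]].
have : (mu `]a, b[ <= mu N)%E.
  apply: le_measure; rewrite ?inE//.
  move=> t /=; rewrite in_itv/= => tab; apply: AN => /(_ I) [] wt.
  by have := wab t tab; rewrite wt ltxx.
by rewrite N0 lebesgue_measure_itv/= lte_fin ab -EFinD lee_fin subr_le0 leNgt ab.
Qed.

End AlmostEverywhere.

(** * Stumpons and cuspons *)

Section Stumpons.
Context {R : realType}.
Local Notation mu := (@lebesgue_measure R).
Variables (M s m L : R) (phi : R -> R) (l : R) (psi : R -> R) (x0 : R).
Hypothesis params : cuspon_parameters M s m.
Hypothesis phiP : cuspon_profile M s m L phi.
Hypothesis l0 : 0 < l.
Hypothesis psiP : stumpon_profile s L l phi psi.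
Hypothesis plateau_condition : - (M * m) - (M + m) * (s - M - m) = s ^+ 2.

Let wp := stumpon_wave_profile params phiP (ltW l0) psiP (fun _ => plateau_condition).

(** The test function is a product of bumps around t = 0 and around the end x0 + l of
    a plateau.  It is so narrow that on its support the moving frame meets no other
    end, and each time slice gives the jump of the defect times the value of the test
    function at the moving end. *)
Lemma stumpon_not_satisfies_weakly :
  ~ satisfies_weakly (travelling_wave psi x0 s).
Proof.
have L0 : 0 < L by case: phiP.
have ll := l0.
move=> [ux hux eqn].
have wf := wave_profile_has_weak_formulation x0 wp.
pose C := s ^+ 3 - - (M * m * (s - M - m)).
have C0 : C != 0.
  rewrite subr_eq0; apply: (@plateau_flux_neq _ M s m l params) => //.
pose d := Num.min l L / 2.
have d0 : 0 < d by rewrite divr_gt0// lt_min l0.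
have dl : 2 * d <= l by rewrite mulrC divfK// ge_min lexx.
have dL : 2 * d <= L by rewrite mulrC divfK// ge_min lexx orbT.
pose tau := d / (`|s| + 1).
have s1 : 0 < `|s| + 1 by rewrite ltr_wpDl.
have tau0 : 0 < tau by rewrite divr_gt0.
pose alpha := bump_function (- tau) tau 0.
(* the factor C makes every slice nonnegative, whatever the sign of the jump *)
pose beta y := C * bump_function (x0 + l - d) (x0 + l + d) 0 y.
have sa : smooth alpha by exact: smooth_bump.
have sb : smooth beta by move=> n; apply: C1nZ; exact: smooth_bump.
have a0 t : ~ (- tau < t < tau) -> alpha t = 0 by exact: bump_outside.
have b0 y : ~ (x0 + l - d < y < x0 + l + d) -> beta y = 0.
  by move=> h; rewrite /beta bump_outside// mulr0.
have tP := test_function_product sa sb a0 b0.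
have st t : - tau < t < tau -> `|s * t| < d.
  rewrite -ltr_norml => h; have : (`|s| + 1) * `|t| < d by rewrite mulrC -ltr_pdivlMr.
  by rewrite normrM; have : 0 <= `|t| by []; lra.
have := eqn _ tP.
rewrite (weak_equation_ae hux wf tP) (weak_equation_flux_defect x0 wp tP).
rewrite (integral_flux_defect_slices x0 wp tP).
have [da _] := sb 1%N.
have E t : (\int[mu]_x (flux_defect s (M * m + (M + m) * (s - M - m)) psi
      (profile_derivative M s m L l psi) (x - (x0 + s * t)) *
      partial_x (fun p : R * R => alpha p.1 * beta p.2) (t, x))%:E =
    (C * (alpha t * beta (l + (x0 + s * t))))%:E)%E.
  have dh (x : R) : is_derive x 1 (fun x => alpha t * beta x) (alpha t * derive1 beta x).
    exact: is_deriveR_Z (is_derive1 (da x)).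
  have h0 y : ~ (- l < y < l + L) -> alpha t * beta (y + (x0 + s * t)) = 0.
    move=> yl; have [/st tt|/a0 ->] := pselect (- tau < t < tau); last by rewrite mul0r.
    rewrite b0 ?mulr0// => /andP[h1 h2]; apply: yl; move: tt; rewrite ltr_norml => /andP[h3 h4].
    by apply/andP; split; lra.
  have dhE : derive1 (fun x => alpha t * beta x) = (fun x => alpha t * derive1 beta x).
    by apply/funext => x; exact: is_derive_derive1.
  have cb' : continuous (derive1 beta) by case: (sb 1%N).
  have h'0 y : ~ (- l < y < l + L) -> alpha t * derive1 beta (y + (x0 + s * t)) = 0.
    move=> yl; have [/st tt|/a0 ->] := pselect (- tau < t < tau); last by rewrite mul0r.
    rewrite (derive1_outside b0) ?mulr0//; move: tt; rewrite ltr_norml => /andP[h3 h4].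
    have [yl'|yl'] := leP y (- l); first by left; lra.
    by right; have [|yl2] := leP (l + L) y; [lra|exfalso; apply: yl; rewrite yl' yl2].
  apply: (integral_defect_jump wp (h := fun x => alpha t * beta x)
    (k := x0 + s * t) (a := - l) (c := l) (b := l + L)
    (c1 := s ^+ 3) (c2 := - (M * m * (s - M - m)))).
  - by apply/andP; split; lra.
  - move=> y yl _; apply: (flux_defect_plateau phiP (ltW l0) psiP) => //.
    by rewrite ltr_norml.
  - move=> y /andP[y1 y2] nS.
    apply: (flux_defect_arch params phiP (ltW l0) psiP) => // k.
    have T0 : 0 < 2 * (L + l) by lra.
    have [k0|k0] := leP k 0.
      have : 2 * (L + l) * k%:~R <= 0 by rewrite pmulr_rle0// lerz0.
      move=> ?; rewrite ger0_norm; lra.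
    have : 2 * (L + l) * 1 <= 2 * (L + l) * k%:~R.
      by rewrite ler_pM2l// -[1]/(1%:~R) ler_int -gtz0_ge1.
    move=> ?; rewrite ler0_norm; lra.
  - by move=> x; case: (dh x).
  - by rewrite dhE => x; apply: cvgMr; exact: cb'.
  - exact: h0.
  - by rewrite dhE; exact: h'0.
under eq_integral do rewrite E.
have cw : continuous (fun t => C * (alpha t * beta (l + (x0 + s * t)))).
  move=> t; apply: cvgMr; apply: cvgM; first exact: (sa 0%N).
  apply: (@continuous_comp _ _ _ (fun t => l + (x0 + s * t)) beta); last exact: (sb 0%N).
  apply: cvgD; first exact: cvg_cst.
  by apply: cvgD; [exact: cvg_cst|apply: cvgMr; exact: cvg_id].
have wE t : C * (alpha t * beta (l + (x0 + s * t))) =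
    C ^+ 2 * (alpha t * bump_function (x0 + l - d) (x0 + l + d) 0 (l + (x0 + s * t))).
  by rewrite /beta; ring.
apply: (integral_pos_neq0 (a := - tau) (b := tau)).
- lra.
- exact: continuous_measurable_fun.
- move=> t; rewrite wE; apply: mulr_ge0; first exact: sqr_ge0.
  by apply: mulr_ge0; exact: bump_ge0.
move=> t tt; rewrite wE; apply: mulr_gt0; first by rewrite exprn_even_gt0.
apply: mulr_gt0; apply: bump_gt0 => //.
by move: (st t tt); rewrite ltr_norml => /andP[? ?]; apply/andP; split; lra.
Qed.

End Stumpons.

Section Cuspons.
Context {R : realType}.

Lemma cuspon_stumpon_profile (M s m L : R) (phi : R -> R) :
  cuspon_profile M s m L phi -> stumpon_profile s L 0 phi phi.
Proof.
move=> [_ [_ [per [_ [_ [even _]]]]]]; split.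
- by rewrite addr0.
- by move=> x; rewrite normr_lt0.
- move=> x _; rewrite subr0; have [x0|x0] := leP 0 x; first by rewrite ger0_norm.
  by rewrite ltr0_norm// even.
Qed.

Lemma cuspon_satisfies_weakly (M s m L : R) (phi : R -> R) (x0 : R) :
  cuspon_parameters M s m -> cuspon_profile M s m L phi ->
  satisfies_weakly (travelling_wave phi x0 s).
Proof.
move=> params phiP; have phiP0 := cuspon_stumpon_profile phiP.
have cond : 0 < 0 :> R -> - (M * m) - (M + m) * (s - M - m) = s ^+ 2.
  by rewrite ltxx.
have wp := stumpon_wave_profile params phiP (lexx 0) phiP0 cond.
apply: (wave_profile_satisfies_weakly x0 wp) => y nS.
exact: (flux_defect_arch params phiP (lexx 0) phiP0).
Qed.

End Cuspons.

Theorem theorem3p1 (R : realType) :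
  (forall u : R * R -> R, periodic_stumpon u ->
     (exists ux : R * R -> R, has_weak_formulation u ux) /\
     ~ satisfies_weakly u) /\
  (forall u : R * R -> R, periodic_cuspon u -> satisfies_weakly u).
Proof.
split=> u.
  move=> [M [s [m [L [phi [l [psi [x0 [[params cond] phiP l0 psiP ->]]]]]]]]].
  split; last exact: stumpon_not_satisfies_weakly params phiP l0 psiP cond.
  have wp := stumpon_wave_profile params phiP (ltW l0) psiP (fun _ => cond).
  eexists; exact: wave_profile_has_weak_formulation x0 wp.
move=> [M [s [m [L [phi [x0 [params phiP ->]]]]]]].
exact: cuspon_satisfies_weakly params phiP.
Qed.
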